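(* Let $a,b,c,d,e,f,h\in\mathbb{C}$, $s=d+e-a-b-c-2$, $\eta=-2(h-c-1)/(h-f-1)$, and let $\gamma_1,\gamma_2$ be the roots of the second degree polynomial $$P_2(x)={}_{4}F_3\!\left(\begin{matrix}-2,\,-x,\,h-c-1,\,\eta+1 \\ {e}-c-2,\,d-c-2,\,\eta\end{matrix}\right).$$ Assume $\mathrm{Re}(s)>0$ and $\mathrm{Re}(c)>0$ (so that both series below converge) and that the parameters are such that all expressions are well defined: $h-f-1\neq0$, $\eta\notin\{0,-1\}$, $e-c-2,\,d-c-2\notin\{0,-1\}$, $P_2$ has degree exactly two, and no lower parameter of the two ${}_5F_4$ series is a nonpositive integer. Then $${}_{5}F_4\!\left(\begin{matrix}a,\,b,\,c,\,f+1,\,h+1 \\ {d},\,e,\,f,\,h\end{matrix}\right)=\frac{\Gamma(d)\Gamma(e)\Gamma(s)}{f\,h\,\Gamma(c)\Gamma(s+a)\Gamma(s+b)}\;{}_{5}F_4\!\left(\begin{matrix}s,\,e-c-2,\,d-c-2,\,1-\gamma_1,\,1-\gamma_2 \\ {s}+a,\,s+b,\,-\gamma_1,\,-\gamma_2\end{matrix}\right).$$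
   Context: ${}_{q+1}F_q(\mathbf{a};\mathbf{b};z)=\sum_{k\ge0}\frac{\prod_i(a_i)_k}{\prod_j(b_j)_k}\frac{z^k}{k!}$ is the generalized hypergeometric function, $(c)_k=c(c+1)\cdots(c+k-1)$; an omitted argument means $z=1$. The ${}_4F_3$ defining $P_2$ is the finite sum over $k=0,1,2$. *)

(* Defs.v *)
From HB Require Import structures.
From mathcomp Require Export all_boot all_order all_algebra.
From mathcomp Require Export all_classical all_reals all_analysis.
From mathcomp Require Export complex.
Set Implicit Arguments.
Unset Strict Implicit.
Unset Printing Implicit Defensive.
Import Order.TTheory GRing.Theory Num.Theory.
Import numFieldNormedType.Exports.
Local Open Scope classical_set_scope.
Local Open Scope ring_scope.
Local Open Scope complex_scope.

(* The hypergeometric series is set up over an arbitrary numFieldType K, whose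
   canonical topology comes from its norm; the theorem uses it at K := R[i]. *)

Definition pochhammer (K : numFieldType) (c : K) (k : nat) : K :=
  \prod_(i < k) (c + i%:R).

Definition hypergeometric_term (K : numFieldType) (us ls : seq K) (z : K)
    (k : nat) : K :=
  (\prod_(u <- us) pochhammer u k) / (\prod_(l <- ls) pochhammer l k)
    * (z ^+ k / k`!%:R).

Definition hypergeometric_converges (K : numFieldType) (us ls : seq K) (z : K) :
    Prop :=
  cvgn (series (hypergeometric_term us ls z)).

(* [limn] is total: the value is meaningful only for a convergent series. *)
Definition hypergeometric (K : numFieldType) (us ls : seq K) (z : K) : K :=
  limn (series (hypergeometric_term us ls z)).

Definition no_nonpos_int (K : numFieldType) (ls : seq K) : Prop :=
  forall l, l \in ls -> forall n : nat, l != - n%:R.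

(* n ^ z = exp (z * ln n), for n > 0. *)
Definition nat_cpow (R : realType) (n : nat) (z : R[i]) : R[i] :=
  let r := expR (complex.Re z * ln n%:R) in
  let t := complex.Im z * ln n%:R in
  (r * cos t) +i* (r * sin t).

(* The complex Gamma function as Euler's limit
   n! n^z / (z (z + 1) ... (z + n)), which converges for every complex z that
   is not a nonpositive integer. *)
Definition Gamma_seq (R : realType) (z : R[i]) : nat -> (R[i] : numFieldType) :=
  fun n => n`!%:R * nat_cpow n z / pochhammer z n.+1.

Definition Gamma (R : realType) (z : R[i]) : R[i] := limn (Gamma_seq z).

(* The value at x of the terminating 4F3 series defining P_2: the terms with
   k > 2 carry the factor (-2)_k = 0. *)
Definition P2_eval (K : numFieldType) (c d e h eta x : K) : K :=
  \sum_(k < 3) hypergeometric_term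
    [:: - 2; - x; h - c - 1; eta + 1] [:: e - c - 2; d - c - 2; eta] 1 k.

(* Main.v *)
(* Write T(c) for the 3F2 with upper parameters a, b, c and lower parameters
   d, e.  Since
     (f + k)(h + k) = (c + k)(c + k + 1) + (f + h - 2c - 1)(c + k)
                      + (f - c)(h - c),
   f h times the left-hand series is c (c + 1) T(c + 2)
   + (f + h - 2c - 1) c T(c + 1) + (f - c)(h - c) T(c).  Thomae's transformation
   turns each T(c + j) into a 3F2 in s, e - c - 2, d - c - 2 shifted by 2 - j.
   Multiplying the k-th term of the unshifted series by k or by k (k - 1)
   produces the shifted ones, so the three transforms recombine into one series
   with k-th term multiplied by P_2(k), and
   P_2(k) = (1 - gamma1)_k (1 - gamma2)_k / ((- gamma1)_k (- gamma2)_k).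

   Thomae's transformation itself is the equality of the two iterated sums of
     (a)_n (b)_n (p)_m (q)_m / (n! m! Gamma(g + n + m)),
   with p = e - c, q = d - c, g = d + e - c, where each inner sum is evaluated by
   Gauss's theorem. *)

Require Import Defs.
From HB Require Import structures.
From mathcomp Require Import all_boot all_order all_algebra.
From mathcomp Require Import all_classical all_reals all_analysis.
From mathcomp Require Import complex.
From mathcomp Require Import ring lra zify.
Set Implicit Arguments.
Unset Strict Implicit.
Unset Printing Implicit Defensive.
Import Order.TTheory GRing.Theory Num.Theory.
Import numFieldNormedType.Exports.
Local Open Scope classical_set_scope.
Local Open Scope ring_scope.
Local Open Scope complex_scope.
Import Normc.

(** * Complex sequences and series *)

Section NumFieldSequences.
Context {K : numFieldType}.
Implicit Types (u v : nat -> K) (l m : K).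

(** Two obstacles shape the proof. Gauss's theorem is needed for arbitrary complex a, b under Re(g -
    a - b) > 0 alone, and g = d + e - c may be a nonpositive integer. The series is therefore
    normalized by the entire function 1/Gamma. As Gamma is only given by Euler's limit, Gauss's
    theorem is obtained from the contiguous relation between g and g + 1: iterated to infinity, it
    turns the quotient of Gamma values into a quotient of Euler sequences. The exchange of the two
    sums requires absolute convergence of the double series. Euler's limit also gives the growth
    |(z)_n| = O(n! n^(Re z - 1)), so the general term is O(n^A m^B (n + m)^y n! m!/(n + m)!), with A
    = Re a + Re b - 2, B = Re p + Re q - 2, y = 1 - Re g. The inverse binomial coefficient decays
    exponentially in the smaller index, so only the exponent of the larger one matters. It is A + y
    = -1 - Re(g - a - b) or B + y = -1 - Re(g - p - q), and since g - a - b is the excess of the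
    left-hand 3F2 and g - p - q = c, both are below -1. *)

Lemma cvgnD u v l m : u @ \oo --> l -> v @ \oo --> m ->
  (fun n => u n + v n) @ \oo --> l + m.
Proof. exact: cvgD. Qed.

Lemma cvgnB u v l m : u @ \oo --> l -> v @ \oo --> m ->
  (fun n => u n - v n) @ \oo --> l - m.
Proof. exact: cvgB. Qed.

Lemma cvgnM u v l m : u @ \oo --> l -> v @ \oo --> m ->
  (fun n => u n * v n) @ \oo --> l * m.
Proof. exact: cvgM. Qed.

Lemma cvgnV u l : l != 0 -> u @ \oo --> l -> (fun n => (u n)^-1) @ \oo --> l^-1.
Proof. exact: cvgV. Qed.

Lemma cvgnMl l u m : u @ \oo --> m -> (fun n => l * u n) @ \oo --> l * m.
Proof. by apply: cvgnM; exact: cvg_cst. Qed.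

Lemma cvgn_seriesZ l u m : series u @ \oo --> m ->
  series (fun n => l * u n) @ \oo --> l * m.
Proof.
move=> um; rewrite (_ : series _ = fun n => l * series u n).
  exact: cvgnMl.
by apply/funext => n; rewrite /series/= mulr_sumr.
Qed.

Lemma cvgn_seriesD u v l m : series u @ \oo --> l -> series v @ \oo --> m ->
  series (fun n => u n + v n) @ \oo --> l + m.
Proof.
move=> ul vm; rewrite (_ : series _ = fun n => series u n + series v n).
  exact: cvgnD.
by apply/funext => n; rewrite /series/= big_split.
Qed.

Lemma cvgn_unique u l m : u @ \oo --> l -> u @ \oo --> m -> l = m.
Proof. by move=> ul um; apply: cvg_unique ul um. Qed.

Lemma cvgn_cst l : (fun=> l : K) @ \oo --> l.
Proof. exact: cvg_cst. Qed.

(** Used to pass to the limit in a contiguous relation that holds for partial sums up to a vanishing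
    boundary term [T]. *)
Lemma cvgn_lincomb_eq (p q : K) (S S' T : nat -> K) l l' :
  (forall n, p * S' n - q * S n = T n) -> S @ \oo --> l -> S' @ \oo --> l' ->
  T @ \oo --> (0 : K) -> p * l' = q * l.
Proof.
move=> H Sl Sl' T0; apply/eqP; rewrite -subr_eq0; apply/eqP.
apply: cvgn_unique T0.
rewrite (_ : T = fun n => p * S' n - q * S n); last by apply/funext => n; rewrite H.
by apply: cvgnB; (apply: cvgM; [exact: cvg_cst|]).
Qed.

Lemma cvgn_lim u l : u @ \oo --> l -> limn u = l.
Proof. by move=> ul; apply: cvg_lim ul. Qed.

Lemma cvgn_eq_ge N u v l : (forall n, (N <= n)%N -> u n = v n) ->
  v @ \oo --> l -> u @ \oo --> l.
Proof.
move=> uv; apply: cvg_trans; apply: near_eq_cvg; exists N => // n /= Nn.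
by rewrite uv.
Qed.

Lemma cvgn_telescope u l : series (fun n => u n.+1 - u n) @ \oo --> l ->
  u @ \oo --> l + u 0%N.
Proof.
move=> ul.
have eu : (fun n => series (fun n => u n.+1 - u n) n + u 0%N) = u.
  by apply/funext => n; rewrite /series/= telescope_sumr// subrK.
have : (fun n => series (fun n => u n.+1 - u n) n + u 0%N) @ \oo --> l + u 0%N.
  by apply: cvgnD ul _; exact: cvg_cst.
by rewrite eu.
Qed.

Lemma cvgn_series_recl u l : series (fun n => u n.+1) @ \oo --> l ->
  series u @ \oo --> u 0%N + l.
Proof.
move=> ul; rewrite -cvg_shiftS.
rewrite (_ : [sequence _]_n = fun n => u 0%N + series (fun n => u n.+1) n).
  by apply: cvgnD ul; exact: cvgn_cst.
by apply/funext => n; rewrite /series/= big_nat_recl.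
Qed.

Lemma cvgn_series_shift u v l : u 0%N = 0 -> (forall n, u n.+1 = v n) ->
  series v @ \oo --> l -> series u @ \oo --> l.
Proof.
move=> u0 uS vl; rewrite -cvg_shiftS.
rewrite (_ : [sequence _]_n = series v)//; apply/funext => n.
rewrite /series/= big_nat_recl// u0 add0r; apply: eq_bigr => i _; exact: uS.
Qed.

End NumFieldSequences.

(** * Convergence in [R[i]] through the real modulus, and exchange of iterated sums *)

Section ComplexSequences.
Context {R : realType}.
Local Notation C := (R[i] : numFieldType).
Implicit Types (u v : nat -> C) (x y : nat -> R).

Lemma normc_ge0 (z : R[i]) : 0 <= normc z.
Proof. by case: z => a b /=; exact: sqrtr_ge0. Qed.

Lemma normcB (z w : R[i]) : normc (z - w) = normc (w - z).
Proof. by rewrite -normcN opprB. Qed.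

Lemma normc_eq0 (z : R[i]) : (normc z == 0) = (z == 0).
Proof. by apply/eqP/eqP => [/eq0_normc//|->]; exact: normc0. Qed.

Lemma normc_gt0 (z : R[i]) : (0 < normc z) = (z != 0).
Proof. by rewrite lt0r normc_ge0 andbT normc_eq0. Qed.

Lemma normcR (r : R) : normc r%:C = `|r|.
Proof. by rewrite /= expr0n /= addr0 sqrtr_sqr. Qed.

Lemma normc_nat n : normc (n%:R : R[i]) = n%:R.
Proof. by rewrite -(rmorph_nat (real_complex R)) normcR ger0_norm. Qed.

Lemma normc_sum (I : Type) (r : seq I) (P : pred I) (F : I -> R[i]) :
  normc (\sum_(i <- r | P i) F i) <= \sum_(i <- r | P i) normc (F i).
Proof.
elim/big_rec2: _ => [|i a b _ H]; first by rewrite normc0.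
by apply: (le_trans (le_normcD _ _)); rewrite lerD2l.
Qed.

Lemma ler_Re_normc (z : R[i]) : `|complex.Re z| <= normc z.
Proof.
case: z => a b /=; rewrite -[`|a|]sqrtr_sqr ler_wsqrtr//.
by rewrite lerDl sqr_ge0.
Qed.

Lemma ler_Im_normc (z : R[i]) : `|complex.Im z| <= normc z.
Proof.
case: z => a b /=; rewrite -[`|b|]sqrtr_sqr ler_wsqrtr//.
by rewrite lerDr sqr_ge0.
Qed.

Lemma normc_le_ReIm (z : R[i]) : normc z <= `|complex.Re z| + `|complex.Im z|.
Proof.
case: z => a b /=; rewrite -[leRHS]ger0_norm ?addr_ge0// -sqrtr_sqr.
rewrite ler_wsqrtr// sqrrD !real_normK ?num_real// -addrA lerD2l lerDr.
by rewrite mulrn_wge0// mulr_ge0.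
Qed.

(** The topology of [R[i]] comes from a norm with values in [R[i]] itself; this moves convergence to
    the real-valued modulus. A positive [e] in [R[i]] is necessarily real, so the two kinds of
    epsilon correspond. *)
Lemma cvgn_normcP u (l : C) :
  (u @ \oo --> l) <-> ((fun n => normc (u n - l : R[i])) @ \oo --> (0 : R)).
Proof.
split.
- move=> /cvgrPdist_lt H; apply/cvgrPdist_lt => e e0.
  have := H e%:C; rewrite ltcR => /(_ e0).
  apply: filterS => n; rewrite sub0r normrN (ger0_norm (normc_ge0 _)).
  by rewrite normcB -ltcR.
- move=> /cvgrPdist_lt H; apply/cvgrPdist_lt => e e0.
  have [eI eR] : complex.Im e = 0 /\ 0 < complex.Re e.
    by move: e0; rewrite ltcE /= => /andP[/eqP-> ->].
  have ee : e = (complex.Re e)%:C by case: (e) eI => a b /= ->.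
  have := H _ eR.
  apply: filterS => n; rewrite sub0r normrN ger0_norm ?normc_ge0//.
  by rewrite normcB ee -ltcR.
Qed.

Lemma cvgn_normc0 u (l : C) x :
  (forall n, normc (u n - l : R[i]) <= x n) -> x @ \oo --> (0 : R) ->
  u @ \oo --> l.
Proof.
move=> H xc; apply/cvgn_normcP.
apply: (@squeeze_cvgr _ _ _ _ (fun=> 0) x) => //; last exact: cvg_cst.
by near=> n; rewrite normc_ge0 H.
Unshelve. all: by end_near. Qed.

Lemma cvgn_normc u (l : C) : u @ \oo --> l ->
  (fun n => normc (u n : R[i])) @ \oo --> (normc (l : R[i]) : R).
Proof.
move=> /cvgn_normcP /cvgrPdist_lt H; apply/cvgrPdist_lt => e /H.
apply: filterS => n; rewrite sub0r normrN ger0_norm ?normc_ge0//.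
apply: le_lt_trans.
rewrite ler_norml lerNl opprB !lerBlDr.
have h1 := le_normcD (u n - l : R[i]) (l : R[i]).
have h2 := le_normcD (l - u n : R[i]) (u n : R[i]).
rewrite !subrK [normc (l - _)]normcB in h1 h2.
by rewrite h1 h2.
Qed.

Lemma cvgn_normc_le u (l : C) (r : R) :
  u @ \oo --> l -> (\forall n \near \oo, normc (u n : R[i]) <= r) ->
  normc (l : R[i]) <= r.
Proof.
move=> /cvgn_normc ul H.
by rewrite -(cvg_lim _ ul)//; apply: limr_le => //; apply/cvg_ex; eexists; exact: ul.
Qed.

Lemma cvgn_ReIm u (a b : R) :
  (fun n => complex.Re (u n : R[i])) @ \oo --> a ->
  (fun n => complex.Im (u n : R[i])) @ \oo --> b ->
  u @ \oo --> (a +i* b : C).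
Proof.
move=> ua ub.
apply: (@cvgn_normc0 _ _ (fun n => `|complex.Re (u n : R[i]) - a|
                                 + `|complex.Im (u n : R[i]) - b|)).
  move=> n; apply: (le_trans (normc_le_ReIm _)); case: (u n) => p q /=.
  by [].
rewrite -[X in _ --> X](addr0 (0 : R)); apply: cvgD.
- rewrite -(@normr0 _ R); apply: cvg_norm; rewrite -(subrr a).
  by apply: cvgB => //; exact: cvg_cst.
- rewrite -(@normr0 _ R); apply: cvg_norm; rewrite -(subrr b).
  by apply: cvgB => //; exact: cvg_cst.
Qed.

(** Completeness is borrowed from [R]: real and imaginary parts are separately Cauchy. The explicit
    error bound is kept because the exchange of sums and the O(1/N) estimate for Gauss's series both
    need it. *)
Lemma cvgn_tail u x : x @ \oo --> (0 : R) ->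
  (forall m n, (m <= n)%N -> normc (u n - u m : R[i]) <= x m) ->
  exists2 l : C, u @ \oo --> l & forall m, normc (l - u m : R[i]) <= x m.
Proof.
move=> x0 H.
have cR (g : R[i] -> R) : (forall z w, g (z - w) = g z - g w) ->
    (forall z, `|g z| <= normc z) -> cvgn (fun n => g (u n)).
  move=> gB gn; apply/cauchy_cvgP/cauchy_exP => e e0.
  move/cvgrPdist_lt: x0 => /(_ _ e0)[N _ HN].
  exists (g (u N)); exists N => // n /= Nn.
  rewrite -ball_normE /= distrC -gB (le_lt_trans (gn _))//.
  rewrite (le_lt_trans (H _ _ Nn))// (le_lt_trans (ler_norm _))//.
  by rewrite -normrN -sub0r; exact: (HN N (leqnn N)).
have cre : cvgn (fun n => complex.Re (u n : R[i])).
  by apply: cR; [case=> ? ? [] | exact: ler_Re_normc].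
have cim : cvgn (fun n => complex.Im (u n : R[i])).
  by apply: cR; [case=> ? ? [] | exact: ler_Im_normc].
have ul := cvgn_ReIm cre cim.
exists (limn (fun n => complex.Re (u n : R[i])) +i*
        limn (fun n => complex.Im (u n : R[i]))) => // m.
apply: (@cvgn_normc_le (fun n => u n - u m)).
  exact: (@cvgnB C u (fun=> u m) _ _ ul (@cvgn_cst C _)).
by exists m => // n /= mn; exact: H.
Qed.

Lemma cvg_series_tail x : cvgn (series x) ->
  (fun n => limn (series x) - series x n) @ \oo --> (0 : R).
Proof.
move=> cx; rewrite -(subrr (limn (series x))).
by apply: cvgB => //; exact: cvg_cst.
Qed.

Lemma series_le_lim x n : (forall k, 0 <= x k) -> cvgn (series x) ->
  series x n <= limn (series x).
Proof.
by move=> x0 cx; apply: nondecreasing_cvgn_le => //; exact: nondecreasing_series.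
Qed.

Lemma normc_cvg_series u x :
  (forall n, normc (u n : R[i]) <= x n) -> cvgn (series x) ->
  exists2 l : C, series u @ \oo --> l &
    forall m, normc (l - series u m : R[i]) <= limn (series x) - series x m.
Proof.
move=> ux cx.
have x0 k : 0 <= x k by exact: le_trans (normc_ge0 _) (ux k).
apply: cvgn_tail; first exact: cvg_series_tail.
move=> m n mn; apply: (@le_trans _ _ (series x n - series x m)).
  by rewrite !sub_series_geq//; apply: (le_trans (normc_sum _ _ _)); exact: ler_sum.
by rewrite lerB// series_le_lim.
Qed.

(** The rectangular sums [D N M] stay within [e M] of [series U N] uniformly in N, and within [e' N]
    of [series V M] uniformly in M; with N = M the two limits coincide. The majorant is a sum of two
    products because the halves n <= m and m <= n of the index square will get different bounds. *)
Lemma cvg_series_swap (u : nat -> nat -> C) (U V : nat -> C) (x y x' y' : nat -> R) :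
  (forall n, 0 <= x n) -> (forall n, 0 <= y n) ->
  (forall n, 0 <= x' n) -> (forall n, 0 <= y' n) ->
  cvgn (series x) -> cvgn (series y) -> cvgn (series x') -> cvgn (series y') ->
  (forall n m, normc (u n m : R[i]) <= x n * y m + x' n * y' m) ->
  (forall n, series (u n) @ \oo --> U n) ->
  (forall m, series (u^~ m) @ \oo --> V m) ->
  exists2 l : C, series U @ \oo --> l & series V @ \oo --> l.
Proof.
move=> x0 y0 x'0 y'0 cx cy cx' cy' H cU cV.
pose D N M : C := \sum_(0 <= n < N) \sum_(0 <= m < M) u n m.
have lin a b (p q : nat -> R) : cvgn (series p) -> cvgn (series q) ->
    series (fun n => a * p n + b * q n) @ \oo -->
    a * limn (series p) + b * limn (series q).
  move=> cp cq.
  rewrite (_ : series _ = fun m => a * series p m + b * series q m).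
    by apply: cvgD; apply: cvgM => //; exact: cvg_cst.
  by apply/funext => m; rewrite /series/= big_split !mulr_sumr.
have cc a b (p q : nat -> R) : cvgn (series p) -> cvgn (series q) ->
    cvgn (series (fun n => a * p n + b * q n)).
  by move=> cp cq; apply/cvg_ex; eexists; exact: lin.
have lc a b (p q : nat -> R) m : cvgn (series p) -> cvgn (series q) ->
    limn (series (fun n => a * p n + b * q n)) - series (fun n => a * p n + b * q n) m
    = a * (limn (series p) - series p m) + b * (limn (series q) - series q m).
  move=> cp cq; rewrite (cvg_lim _ (lin a b _ _ cp cq))//.
  by rewrite /series/= big_split/= !mulrBr !mulr_sumr opprD addrACA.
have tU n M : normc (U n - series (u n) M : R[i]) <=
    x n * (limn (series y) - series y M) + x' n * (limn (series y') - series y' M).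
  have [l ul lM] := normc_cvg_series (H n) (cc _ _ _ _ cy cy').
  by rewrite (cvg_unique _ (cU n) ul) // (le_trans (lM M))// lc.
have tV m N : normc (V m - series (u^~ m) N : R[i]) <=
    y m * (limn (series x) - series x N) + y' m * (limn (series x') - series x' N).
  have H' n : normc (u n m : R[i]) <= y m * x n + y' m * x' n.
    by rewrite mulrC [y' m * _]mulrC.
  have [l ul lM] := normc_cvg_series H' (cc _ _ _ _ cx cx').
  by rewrite (cvg_unique _ (cV m) ul) // (le_trans (lM N))// lc.
pose e M := limn (series x) * (limn (series y) - series y M)
          + limn (series x') * (limn (series y') - series y' M).
pose e' N := limn (series y) * (limn (series x) - series x N)
          + limn (series y') * (limn (series x') - series x' N).
have ge0 (p : nat -> R) n : (forall k, 0 <= p k) -> cvgn (series p) ->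
  0 <= limn (series p) - series p n by move=> *; rewrite subr_ge0 series_le_lim.
have UD N M : normc (series U N - D N M : R[i]) <= e M.
  rewrite /D /series/= -sumrB (le_trans (normc_sum _ _ _))//.
  apply: (le_trans (ler_sum _ (fun n _ => tU n M))).
  rewrite big_split /= -!mulr_suml lerD// ler_wpM2r ?ge0//.
  - exact: (series_le_lim N x0 cx).
  - exact: (series_le_lim N x'0 cx').
have VD M N : normc (series V M - D N M : R[i]) <= e' N.
  rewrite /D exchange_big /series/= -sumrB (le_trans (normc_sum _ _ _))//.
  apply: (le_trans (ler_sum _ (fun m _ => tV m N))).
  rewrite big_split /= -!mulr_suml lerD// ler_wpM2r ?ge0//.
  - exact: (series_le_lim M y0 cy).
  - exact: (series_le_lim M y'0 cy').
have tl0 a b (p q : nat -> R) : cvgn (series p) -> cvgn (series q) ->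
    (fun n => a * (limn (series p) - series p n) +
              b * (limn (series q) - series q n)) @ \oo --> (0 : R).
  move=> cp cq; rewrite (_ : (0 : R) = a * 0 + b * 0); last by rewrite !mulr0 addr0.
  by apply: cvgnD; apply: cvgnMl; exact: cvg_series_tail.
have e0 : e @ \oo --> (0 : R) by exact: tl0.
have e'0 : e' @ \oo --> (0 : R) by exact: tl0.
have UV N M : normc (series U N - series V M : R[i]) <= e M + e' N.
  have -> : series U N - series V M = (series U N - D N M) - (series V M - D N M) by ring.
  by rewrite (le_trans (le_normcD _ _))// normcN lerD.
have [||l Ul _] := @normc_cvg_series U
    (fun n => limn (series y) * x n + limn (series y') * x' n).
(* For M = 0 the partial sum is empty, so the tail bound bounds [U n] itself. *)
- move=> n; have := tU n 0%N; rewrite /series/= !big_geq// !subr0.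
  by rewrite mulrC [x' n * _]mulrC.
- exact: cc.
exists l => //; apply: (@cvgn_normc0 _ _ (fun M => e M + e' M + normc (series U M - l : R[i]))).
  move=> M; have -> : series V M - l = - (series U M - series V M) + (series U M - l) by ring.
  by rewrite (le_trans (le_normcD _ _))// normcN lerD.
rewrite -[X in _ --> X](addr0 (0 : R)); apply: cvgD; last exact/cvgn_normcP.
by rewrite -[X in _ --> X](addr0 (0 : R)); apply: cvgD.
Qed.

(** Convergence of an infinite product: 1 + x <= exp x keeps [u] below its initial modulus times exp
    of the sum of [x], so the increments are absolutely summable. The limit may be 0. *)
Lemma cvgn_ratio u x : (forall n, 0 <= x n) -> cvgn (series x) ->
  (forall n, normc (u n.+1 - u n : R[i]) <= x n * normc (u n : R[i])) ->
  exists l : C, u @ \oo --> l.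
Proof.
move=> x0 cx H.
have B n : normc (u n : R[i]) <= normc (u 0%N : R[i]) * expR (series x n).
  elim: n => [|n IH]; first by rewrite /series/= big_geq// expR0 mulr1.
  have -> : u n.+1 = u n + (u n.+1 - u n) by ring.
  apply: (le_trans (le_normcD _ _)); apply: (le_trans (lerD (lexx _) (H n))).
  rewrite -[X in X + _]mul1r -mulrDl seriesSr expRD mulrA mulrC ler_pM ?normc_ge0//.
    by rewrite addr_ge0.
  exact: expR_ge1Dx.
have [] := @normc_cvg_series (fun n => u n.+1 - u n)
  (fun n => (normc (u 0%N : R[i]) * expR (limn (series x))) * x n).
- move=> n; apply: (le_trans (H n)); rewrite mulrC ler_wpM2r//.
  apply: (le_trans (B n)); rewrite ler_wpM2l ?normc_ge0// ler_expR.
  exact: series_le_lim.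
- by apply/cvg_ex; eexists; apply: cvgn_seriesZ; exact: cx.
- move=> l ul _; exists (l + u 0%N).
  exact: (@cvgn_telescope C).
Qed.

End ComplexSequences.

(** * Powers and elementary inequalities *)

Section RealPowers.
Context {R : realType}.
Implicit Types x y : R.

(* The power (n + 1)^x. *)
Definition npow (n : nat) x : R := expR (x * ln n.+1%:R).

Lemma npow_gt0 n x : 0 < npow n x.
Proof. exact: expR_gt0. Qed.

Lemma npow_ge0 n x : 0 <= npow n x.
Proof. exact: expR_ge0. Qed.

Lemma npowD n x y : npow n (x + y) = npow n x * npow n y.
Proof. by rewrite /npow mulrDl expRD. Qed.

Lemma npow1 n : npow n 1 = n.+1%:R.
Proof. by rewrite /npow mul1r lnK// posrE. Qed.

Lemma npow0n x : npow 0 x = 1.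
Proof. by rewrite /npow ln1 mulr0 expR0. Qed.

Lemma npowN n x : npow n (- x) = (npow n x)^-1.
Proof. by rewrite /npow mulNr expRN. Qed.

Lemma npowN1 n : npow n (- 1) = n.+1%:R^-1.
Proof. by rewrite npowN npow1. Qed.

(** The hypotheses say that m + 1 and n + 1 differ by a factor of at most [k] either way, so the
    bound k^|x| serves exponents of both signs. *)
Lemma npow_comparable k m n x : (m < k * n.+1)%N -> (n < k * m.+1)%N ->
  npow m x <= expR (`|x| * ln k%:R) * npow n x.
Proof.
move=> mn nm; have k0 : (0 < k)%N by case: k mn nm.
rewrite -expRD ler_expR -lerBlDr -mulrBr (le_trans (ler_norm _))// normrM.
rewrite ler_wpM2l// ler_norml lerNl opprB !lerBlDr.
by rewrite -!lnM ?posrE ?ltr0n// -!natrM !ler_ln ?posrE ?ltr0n ?muln_gt0 ?k0// !ler_nat mn nm.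
Qed.

Lemma ln_ratio_bounds n :
  n.+2%:R^-1 <= ln (n.+2%:R : R) - ln n.+1%:R <= n.+1%:R^-1.
Proof.
have p1 : 0 < n.+1%:R :> R by rewrite ltr0n.
have p2 : 0 < n.+2%:R :> R by rewrite ltr0n.
have e1 : n.+2%:R = n.+1%:R + 1 :> R by rewrite -natr1.
apply/andP; split.
- rewrite -lerN2 opprB -ln_div ?posrE//.
  have -> : n.+1%:R / n.+2%:R = 1 + (- n.+2%:R^-1) :> R.
    by rewrite {1 2}e1; field; lra.
  by apply: le_ln1Dx; rewrite ltrN2 invf_lt1// ltr1n.
- rewrite -ln_div ?posrE//.
  have -> : n.+2%:R / n.+1%:R = 1 + n.+1%:R^-1 :> R.
    by rewrite e1; field; lra.
  by apply: le_ln1Dx; rewrite (lt_trans _ (_ : 0 < _))// ?invr_gt0//; lra.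
Qed.

(** Telescoping in place of the integral test: with d = -1 - x, the term (n + 2)^x is at most 1/d
    times the drop of y^(-d) from n + 1 to n + 2. *)
Lemma cvg_series_npow x : x < - 1 -> cvgn (series (npow ^~ x)).
Proof.
move=> x1; pose d := - 1 - x; have d0 : 0 < d by rewrite /d; lra.
have step n : d * npow n.+1 x <= npow n (- d) - npow n.+1 (- d).
  have -> : x = - d - 1 by rewrite /d; ring.
  rewrite npowD npowN1 lerBrDr -mulrCA -{2}(mulr1 (npow n.+1 _)) -mulrDr.
  have -> : npow n (- d) = npow n.+1 (- d) * expR (d * (ln n.+2%:R - ln n.+1%:R)).
    by rewrite -expRD; congr expR; ring.
  rewrite ler_wpM2l ?npow_ge0// (le_trans _ (expR_ge1Dx _))// addrC lerD2l.
  by rewrite ler_wpM2l ?(ltW d0)//; case/andP: (ln_ratio_bounds n).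
have B n : series (npow ^~ x) n.+1 <= 1 + d^-1 * (1 - npow n (- d)).
  elim: n => [|n IH]; first by rewrite /series/= big_nat1 !npow0n; lra.
  rewrite seriesSr (le_trans (lerD IH (lexx _)))// -addrA lerD2l.
  by rewrite -lerBrDl -mulrBr ler_pdivlMl// (le_trans (step n))//; lra.
apply: nondecreasing_is_cvgn; first by apply: nondecreasing_series => n _ _; exact: npow_ge0.
exists (1 + d^-1) => _ [n _ <-].
apply: (@le_trans _ _ (series (npow ^~ x) n.+1)).
  by rewrite seriesSr lerDl npow_ge0.
rewrite (le_trans (B n))// lerD2l ler_piMr ?invr_ge0 ?(ltW d0)//.
by rewrite gerBl npow_ge0.
Qed.

Lemma npow_le_exp2 x : exists2 c : R, 0 <= c & forall n, npow n x <= c * 2 ^+ n.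
Proof.
pose w := `|x| + 1; have w0 : 0 < w by rewrite ltr_wpDl.
have l2 : 0 < ln 2 :> R by rewrite ln_gt0// ltr1n.
(* Multiplying ln y <= e y - ln e by [w] gives slope exactly ln 2 in y. The summand 1 in [w] keeps
   it positive when x = 0. *)
pose e := ln 2 / w; have e0 : 0 < e by rewrite divr_gt0.
exists (expR (- (w * ln e)) * 2); first by rewrite mulr_ge0// expR_ge0.
move=> n.
have -> : expR (- (w * ln e)) * 2 * 2 ^+ n = expR (- (w * ln e) + ln 2 * n.+1%:R).
  by rewrite expRD -mulrA -exprS mulrC expRM_natr lnK ?posrE// mulrC.
rewrite ler_expR.
have n0 : 0 < n.+1%:R :> R by rewrite ltr0n.
have le1 : ln n.+1%:R <= n.+1%:R * e - ln e.
  rewrite lerBrDr -lnM ?posrE//.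
  by apply: ltW; apply: ln_sublinear; rewrite mulr_gt0.
apply: (@le_trans _ _ (w * ln n.+1%:R)).
  rewrite ler_wpM2r ?ln_ge0 ?ler1n// (le_trans (ler_norm _))// /w; lra.
apply: (@le_trans _ _ (w * (n.+1%:R * e - ln e))); first by rewrite ler_wpM2l ?(ltW w0).
rewrite le_eqVlt; apply/orP; left; apply/eqP; rewrite /e; field; lra.
Qed.

Lemma norm_sin_le x : `|sin x| <= `|x|.
Proof.
wlog x0 : x / 0 <= x.
  move=> H; have [/H//|x0] := lerP 0 x.
  by rewrite -normrN -sinN -[leRHS]normrN; apply: H; rewrite oppr_ge0 ltW.
have [|c _] := @MVT_segment R sin cos 0 x x0 (fun y _ => is_derive_sin y).
  exact/continuous_subspaceT/continuous_sin.
by rewrite sin0 !subr0 => ->; rewrite normrM ler_piMl// cos_max.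
Qed.

Lemma norm_cosB1_le x : `|cos x - 1| <= `|x|.
Proof.
wlog x0 : x / 0 <= x.
  move=> H; have [/H//|x0] := lerP 0 x.
  by rewrite -cosN -[leRHS]normrN; apply: H; rewrite oppr_ge0 ltW.
have [|c _] := @MVT_segment R cos (fun y => - sin y) 0 x x0 (fun y _ => is_derive_cos y).
  exact/continuous_subspaceT/continuous_cos.
by rewrite cos0 subr0 => ->; rewrite normrM ler_piMl// normrN sin_max.
Qed.

Lemma norm_cosB1_le2 x : `|cos x - 1| <= x ^+ 2.
Proof.
have -> : cos x - 1 = - (sin (x / 2) ^+ 2 *+ 2).
  have {1}-> : x = (x / 2) *+ 2 by rewrite -mulr_natr; field.
  by rewrite cos_mulr2n sin2cos2; ring.
rewrite normrN normrMn normrX.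
have : `|sin (x / 2)| ^+ 2 <= `|x / 2| ^+ 2.
  by rewrite lerXn2r ?nnegrE ?normr_ge0// norm_sin_le.
rewrite -(normrX 2 (x / 2)) (ger0_norm (sqr_ge0 (x / 2))) => h.
have : 0 <= x ^+ 2 by exact: sqr_ge0.
have e : (x / 2) ^+ 2 = x ^+ 2 / 4 by field.
rewrite {}e in h; lra.
Qed.

Lemma norm_sinB_le x : `|sin x - x| <= x ^+ 2.
Proof.
wlog x0 : x / 0 <= x.
  move=> H; have [/H//|x0] := lerP 0 x.
  rewrite -normrN -[x ^+ 2]sqrrN opprB.
  have -> : x - sin x = sin (- x) - - x by rewrite sinN; ring.
  by apply: H; rewrite oppr_ge0 ltW.
have [|c] := @MVT_segment R (fun y => sin y - y) (fun y => cos y - 1) 0 x x0.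
- apply: continuous_subspaceT => y.
  by apply: cvgB; [exact: continuous_sin|exact: cvg_id].
rewrite in_itv/= sin0 !subr0 => /andP[c0 cx] ->; rewrite normrM (ger0_norm x0).
rewrite expr2 ler_wpM2r// (le_trans (norm_cosB1_le _))// ger0_norm//.
Qed.

End RealPowers.

(** * The complex Gamma function *)

Section Pochhammer.
Context {K : numFieldType}.
Implicit Types (c : K).

Lemma pochhammer0 c : pochhammer c 0 = 1.
Proof. by rewrite /pochhammer big_ord0. Qed.

Lemma pochhammerSr c n : pochhammer c n.+1 = pochhammer c n * (c + n%:R).
Proof. by rewrite /pochhammer big_ord_recr. Qed.

Lemma pochhammerS c n : pochhammer c n.+1 = c * pochhammer (c + 1) n.
Proof.
rewrite /pochhammer big_ord_recl addr0; congr (_ * _); apply: eq_bigr => i _.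
by rewrite lift0 -addrA nat1r.
Qed.

Lemma pochhammer_neq0 c n : (forall m : nat, c != - m%:R) -> pochhammer c n != 0.
Proof.
by move=> H; apply/prodf_neq0 => i _; rewrite addr_eq0.
Qed.

End Pochhammer.

Section GammaFunction.
Context {R : realType}.
Local Notation C := (R[i] : numFieldType).
Implicit Types z w : R[i].

Definition cexp z : R[i] :=
  (expR (complex.Re z) * cos (complex.Im z)) +i*
  (expR (complex.Re z) * sin (complex.Im z)).

Lemma cexpD z w : cexp (z + w) = cexp z * cexp w.
Proof.
case: z w => a b [c d]; rewrite /cexp/=; simpc; rewrite expRD cosD sinD.
by congr (_ +i* _); ring.
Qed.

Lemma cexp0 : cexp 0 = 1.
Proof. by rewrite /cexp/= expR0 cos0 sin0 mulr1 mulr0. Qed.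

Lemma normc_cexp z : normc (cexp z) = expR (complex.Re z).
Proof.
rewrite /cexp/= !exprMn -mulrDr cos2Dsin2 mulr1 sqrtr_sqr ger0_norm//.
Qed.

Lemma cexp_neq0 z : cexp z != 0.
Proof. by rewrite -normc_gt0 normc_cexp expR_gt0. Qed.

Lemma cexpN z : cexp (- z) = (cexp z)^-1.
Proof.
by apply: (mulIf (cexp_neq0 z)); rewrite -cexpD addNr cexp0 mulVf// cexp_neq0.
Qed.

(** The constant 8 is crude. If |z| > 1/2, then 8 |z|^2 >= 2 and the triangle inequality suffices;
    otherwise the real and the imaginary part are each at most 7/2 |z|^2. *)
Lemma normc_cexpB1D z :
  normc (cexp z - 1 - z) <= 8 * normc z ^+ 2 * expR (normc z).
Proof.
set r := normc z; have r0 : 0 <= r by exact: normc_ge0.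
have e1 : 1 + r <= expR r by exact: expR_ge1Dx.
have [r2|r2] := lerP r 2^-1; last first.
  apply: (@le_trans _ _ (expR r + (1 + r))).
    rewrite (le_trans (le_normcD _ _))// (le_trans (lerD (le_normcD _ _) (lexx _)))//.
    rewrite !normcN normc1 normc_cexp -addrA lerD2r ler_expR.
    exact: le_trans (ler_norm _) (ler_Re_normc _).
  apply: (@le_trans _ _ (2 * expR r)); first by lra.
  rewrite ler_wpM2r ?expR_ge0//; nra.
apply: (@le_trans _ _ (7 * r ^+ 2)); last first.
  have := sqr_ge0 r; nra.
have hu := ler_Re_normc z; have hv := ler_Im_normc z.
apply: (le_trans (normc_le_ReIm _)).
case: z hu hv @r r0 e1 r2 => u v /=; set r := Num.sqrt _ => hu hv r0 e1 r2.
rewrite oppr0 addr0.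
have E1 := expR_ge1Dx u.
(* Follows from exp u <= 1/(1 - u) and (1 + u + 2 u^2)(1 - u) = 1 + u^2 (1 - 2 u), which is at least
   1 as u <= 1/2. *)
have E2 : expR u <= 1 + u + 2 * u ^+ 2.
  have u2 : u <= 2^-1 by rewrite (le_trans (ler_norm _))// (le_trans hu).
  have := expR_ge1Dx (- u); rewrite expRN => h.
  have : expR u * (1 - u) <= 1.
    by rewrite mulrC -ler_pdivlMr ?expR_gt0// mul1r.
  move=> h2; rewrite -(@ler_pM2r _ (1 - u)); last by lra.
  rewrite (le_trans h2)//; have := sqr_ge0 u; nra.
have hc := norm_cosB1_le2 v; have hs := norm_sinB_le v.
have hc1 := cos_max v; have hs1 := norm_sin_le v.
have u2r : u ^+ 2 <= r ^+ 2 by rewrite -(real_normK (num_real u)) lerXn2r// nnegrE.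
have v2r : v ^+ 2 <= r ^+ 2 by rewrite -(real_normK (num_real v)) lerXn2r// nnegrE.
have ur : `|u| * `|v| <= r ^+ 2 by rewrite expr2 ler_pM.
have hu1 : `|1 + u| <= 3 / 2.
  rewrite (le_trans (ler_normD _ _))// normr1; lra.
have -> : 7 * r ^+ 2 = 7 / 2 * r ^+ 2 + 7 / 2 * r ^+ 2 by field.
apply: lerD.
- have -> : expR u * cos v - 1 - u =
      (expR u - 1 - u) * cos v + (1 + u) * (cos v - 1) by ring.
  rewrite (le_trans (ler_normD _ _))// !normrM.
  have hE : `|expR u - 1 - u| <= 2 * u ^+ 2 by rewrite ger0_norm; lra.
  have p1 := ler_pM (normr_ge0 _) (normr_ge0 _) hE hc1.
  have p2 := ler_pM (normr_ge0 _) (normr_ge0 _) hu1 hc.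
  lra.
- have -> : expR u * sin v - v = (expR u - 1) * sin v + (sin v - v) by ring.
  rewrite (le_trans (ler_normD _ _))// normrM.
  have u2 : u ^+ 2 <= `|u| / 2.
    by rewrite -(real_normK (num_real u)) expr2 ler_wpM2l// (le_trans hu).
  have hE : `|expR u - 1| <= 2 * `|u|.
    have n1 := ler_norm u; have n2 := ler_norm (- u); rewrite normrN in n2.
    by rewrite ler_norml; apply/andP; split; lra.
  have p1 := ler_pM (normr_ge0 _) (normr_ge0 _) hE hs1.
  have r0' := sqr_ge0 r; lra.
Qed.

Lemma nat_cpowE n z : nat_cpow n z = cexp (z * (ln (n%:R : R))%:C).
Proof. by case: z => a b; rewrite /nat_cpow /cexp/=; simpc. Qed.

Lemma nat_cpowD n z w : nat_cpow n (z + w) = nat_cpow n z * nat_cpow n w.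
Proof. by rewrite !nat_cpowE mulrDl cexpD. Qed.

Lemma nat_cpow_neq0 n z : nat_cpow n z != 0.
Proof. by rewrite nat_cpowE cexp_neq0. Qed.

Lemma nat_cpow1 n : nat_cpow n.+1 (1 : R[i]) = n.+1%:R.
Proof.
rewrite nat_cpowE mul1r /cexp/= lnK ?posrE// cos0 sin0 mulr1 mulr0.
by rewrite -(rmorph_nat (real_complex R)).
Qed.

Lemma normc_nat_cpow n z : normc (nat_cpow n.+1 z) = npow n (complex.Re z).
Proof.
by rewrite nat_cpowE normc_cexp /npow; case: z => a b /=; rewrite mulr0 subr0.
Qed.

Lemma Gamma_seq_shift z n : z + n.+1%:R + 1 != 0 ->
  Gamma_seq z n.+1 = z^-1 * Gamma_seq (z + 1) n.+1 * (1 + (z + 1) / n.+1%:R).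
Proof.
move=> H; rewrite /Gamma_seq.
have n0 : n.+1%:R != 0 :> R[i] by rewrite pnatr_eq0.
rewrite nat_cpowD nat_cpow1 [in LHS]pochhammerS [pochhammer (z + 1) n.+2]pochhammerSr.
rewrite [z * _]mulrC !invfM.
have -> : z + 1 + n.+1%:R = z + n.+1%:R + 1 by rewrite addrAC.
(* At z = 0 both sides are 0, the inverse of 0 being 0. *)
have [->|z0] := eqVneq z 0; first by rewrite invr0 !mulr0 !mul0r.
move: n0 H; set N := n.+1%:R; set P := (pochhammer _ _)^-1; set q := nat_cpow _ _.
by move=> n0 H; field; rewrite nat1r n0 z0 H.
Qed.

(* Consecutive terms of Euler's sequence differ by the factor
   (1 + 1/n)^z / (1 + z/(n + 1)), which this shows to be 1 + O(1/n^2). *)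
Lemma Gamma_ratio_bound z : exists2 D : R, 0 <= D & forall n,
  normc (cexp (z * (ln n.+2%:R - ln n.+1%:R)%:C) - 1 - z / n.+2%:R) <= D * npow n (- 2).
Proof.
have z0 := normc_ge0 z.
exists (8 * normc z ^+ 2 * expR (normc z) + normc z).
  by rewrite addr_ge0// !mulr_ge0 ?expR_ge0// sqr_ge0.
move=> n; set t := ln _ - ln _; have /andP[t1 t2] : n.+2%:R^-1 <= t <= n.+1%:R^-1.
  exact: ln_ratio_bounds.
have p1 : 0 < n.+1%:R :> R by rewrite ltr0n.
have p2 : 0 < n.+2%:R :> R by rewrite ltr0n.
have i1 : 0 < n.+1%:R^-1 :> R by rewrite invr_gt0.
have i2 : 0 < n.+2%:R^-1 :> R by rewrite invr_gt0.
have i3 : n.+1%:R^-1 <= 1 :> R by rewrite invf_le1// ler1n.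
have i4 : n.+1%:R^-1 - n.+2%:R^-1 <= n.+1%:R^-1 ^+ 2 :> R.
  have -> : n.+1%:R^-1 - n.+2%:R^-1 = n.+1%:R^-1 * n.+2%:R^-1 :> R.
    by rewrite -[n.+2%:R]natr1; field; rewrite nat1r natr1 !pnatr_eq0.
  by rewrite expr2 ler_wpM2l ?(ltW i1)// lef_pV2 ?posrE// ler_nat.
have -> : npow n (- 2) = n.+1%:R^-1 ^+ 2 :> R.
  by rewrite (_ : - 2 = - 1 + - 1 :> R) ?npowD ?npowN1//; ring.
have i5 : (n.+2%:R^-1)%:C = n.+2%:R^-1 :> R[i].
  by rewrite -[(n.+2%:R^-1)%:C]/(real_complex R _) fmorphV rmorph_nat.
rewrite -{}i5.
move: (n.+1%:R^-1 : R) (n.+2%:R^-1 : R) i1 i2 i3 i4 t1 t2 => p q i1 i2 i3 i4 t1 t2.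
have t0 : 0 <= t by lra.
have hw : normc (z * t%:C) = normc z * t by rewrite normcM normcR ger0_norm.
have -> : cexp (z * t%:C) - 1 - z * q%:C =
    (cexp (z * t%:C) - 1 - z * t%:C) + z * (t - q)%:C.
  by rewrite (rmorphB (real_complex R) t q) mulrBr addrA subrK.
rewrite (le_trans (le_normcD _ _))// mulrDl lerD//.
- rewrite (le_trans (normc_cexpB1D _))// hw exprMn.
  have h1 : expR (normc z * t) <= expR (normc z).
    by rewrite ler_expR ler_piMr//; lra.
  have h2 : t ^+ 2 <= p ^+ 2 by rewrite lerXn2r// nnegrE; lra.
  rewrite [leRHS]mulrAC ler_pM ?expR_ge0//.
    by rewrite !mulr_ge0// sqr_ge0.
  by rewrite mulrA ler_wpM2l// mulr_ge0// sqr_ge0.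
- rewrite normcM normcR ler_wpM2l// ger0_norm; lra.
Qed.

Lemma natC n : (n%:R : R)%:C = n%:R :> R[i].
Proof. exact: (rmorph_nat (real_complex R)). Qed.

Lemma Re_gt0_neqN z : 0 < complex.Re z -> forall m : nat, z != - m%:R.
Proof.
move=> z0 m; apply: contraTneq z0 => ->; rewrite -natC /= -leNgt.
by rewrite oppr_le0.
Qed.

Lemma Gamma_seq_step z n : (forall m : nat, z != - m%:R) ->
  Gamma_seq z n.+2 * (1 + z / n.+2%:R) =
  Gamma_seq z n.+1 * cexp (z * (ln n.+2%:R - ln n.+1%:R)%:C).
Proof.
move=> zN; rewrite /Gamma_seq.
have -> : nat_cpow n.+2 z = nat_cpow n.+1 z * cexp (z * (ln n.+2%:R - ln n.+1%:R)%:C).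
  rewrite !nat_cpowE -cexpD -mulrDr; congr (cexp (_ * _)).
  by rewrite (rmorphB (real_complex R)) addrC subrK.
have n0 : n.+2%:R != 0 :> R[i] by rewrite pnatr_eq0.
have P0 := pochhammer_neq0 n.+2 zN.
have z2 : z + n.+2%:R != 0 by rewrite addr_eq0.
rewrite pochhammerSr factS natrM.
move: (n.+2%:R : R[i]) n0 z2 (pochhammer z n.+2) P0 => N n0 z2 P P0.
by field; rewrite P0 z2 n0.
Qed.

(* The limit is nonzero because the inverse sequence satisfies the same
   estimate and hence converges too. *)
Lemma cvg_Gamma_seq_Re_gt0 z : 0 < complex.Re z ->
  exists2 l : C, l != 0 & Gamma_seq z @ \oo --> l.
Proof.
move=> z0; have zN := Re_gt0_neqN z0.
have [D D0 HD] := Gamma_ratio_bound z.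
pose t n : R := ln n.+2%:R - ln n.+1%:R.
pose u : nat -> C := fun n => Gamma_seq z n.+1.
have u0 n : u n != 0.
  by rewrite !mulf_neq0 ?invr_eq0 ?nat_cpow_neq0 ?pochhammer_neq0// pnatr_eq0 -lt0n fact_gt0.
have cx : cvgn (series (fun n => D * npow n (- 2) : R)).
  by apply/cvg_ex; eexists; apply: cvgn_seriesZ; apply: cvg_series_npow; lra.
have x0 n : 0 <= D * npow n (- 2) by rewrite mulr_ge0// npow_ge0.
(* Re z > 0 gives this bound and also |exp(- z t)| <= 1, so clearing denominators costs no constant,
   neither for [u] nor for its inverse. *)
have d1 n : 1 <= normc (1 + z / n.+2%:R).
  apply: le_trans (ler_Re_normc _); apply: le_trans (ler_norm _).
  rewrite -natC -fmorphV; case: (z) z0 => a b /= a0.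
  by rewrite mulr0 subr0 lerDl divr_ge0// ltW.
have d0 n : 1 + z / n.+2%:R != 0 by rewrite -normc_gt0 (lt_le_trans _ (d1 n)).
have st n : u n.+1 * (1 + z / n.+2%:R) = u n * cexp (z * (t n)%:C).
  exact: Gamma_seq_step.
have [l ul] : exists l : C, u @ \oo --> l.
  apply: (cvgn_ratio x0 cx) => n.
  rewrite -(ler_pM2r (lt_le_trans ltr01 (d1 n))) -normcM.
  have -> : (u n.+1 - u n) * (1 + z / n.+2%:R) =
     u n * (cexp (z * (t n)%:C) - 1 - z / n.+2%:R) by rewrite mulrBl st; ring.
  rewrite normcM mulrC (@le_trans _ _ (D * npow n (- 2) * normc (u n)))//.
    by rewrite ler_wpM2r ?normc_ge0//; exact: HD.
  by rewrite ler_peMr// mulr_ge0// normc_ge0.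
have [m vm] : exists m : C, (fun n => (u n)^-1 : C) @ \oo --> m.
  apply: (cvgn_ratio x0 cx) => n.
  have -> : (u n.+1)^-1 - (u n)^-1 =
     - (cexp (- (z * (t n)%:C)) * (cexp (z * (t n)%:C) - 1 - z / n.+2%:R)) * (u n)^-1.
    rewrite cexpN; apply/eqP; rewrite -subr_eq0; apply/eqP.
    have -> : (u n.+1)^-1 = (1 + z / n.+2%:R) * (cexp (z * (t n)%:C))^-1 * (u n)^-1.
      have -> : u n.+1 = u n * cexp (z * (t n)%:C) * (1 + z / n.+2%:R)^-1.
        by rewrite -st mulfK.
      by rewrite (invfM (u n * _)) (invfM (u n)) invrK mulrC mulrCA mulrC.
    move: (z / _) (u n) (u0 n) (cexp _) (cexp_neq0 (z * (t n)%:C)) => w p p0 E E0.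
    by field; rewrite p0 E0.
  rewrite normcM normcN normcM ler_wpM2r ?normc_ge0// normc_cexp.
  rewrite -[leRHS]mul1r; apply: ler_pM; rewrite ?expR_ge0 ?normc_ge0//; last exact: HD.
  rewrite expR_le1.
  have : 0 <= t n.
    by case/andP: (@ln_ratio_bounds R n) => h _; rewrite (le_trans _ h)// invr_ge0.
  case: (z) z0 => a b /= a0 t0; rewrite mulr0 subr0 oppr_le0 mulr_ge0//.
  exact: ltW.
have uv := @cvgnM C _ _ _ _ ul vm.
exists l; last by rewrite -cvg_shiftS; exact: ul.
have e1 : (fun n => u n * (u n)^-1 : C) = fun=> 1.
  by apply/funext => n; rewrite mulfV.
rewrite e1 in uv.
have := @cvgn_unique C _ _ _ uv (@cvgn_cst C _).
by apply: contra_eq_neq => ->; rewrite mul0r eq_sym oner_eq0.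
Qed.

(** Stands in for analytic continuation: finitely many unit shifts reach the right half-plane, and a
    functional equation carries the property back. *)
Lemma Re_shift_ind (P : R[i] -> Prop) :
  (forall z, 0 < complex.Re z -> P z) -> (forall z, P (z + 1) -> P z) ->
  forall z, P z.
Proof.
move=> P0 PS z.
have [n] : exists n : nat, 0 < complex.Re z + n%:R.
  exists (Num.bound `|complex.Re z|).
  have := archi_boundP (normr_ge0 (complex.Re z)).
  by have := ler_norm (- complex.Re z); rewrite normrN; lra.
elim: n z => [|n IH] z; first by rewrite addr0; exact: P0.
move=> h; apply: PS; apply: IH; move: h; case: z => a b /=.
by rewrite -natr1; lra.
Qed.

Lemma cvgn_invC : (fun n => n.+1%:R^-1 : C) @ \oo --> (0 : C).
Proof.
apply: (@cvgn_normc0 _ _ _ (fun n => n.+1%:R^-1)); last exact: cvg_harmonic.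
by move=> n; rewrite subr0 normcV normc_nat.
Qed.

Lemma cvg_Gamma_seq_shift z (l : C) :
  Gamma_seq (z + 1) @ \oo --> l -> Gamma_seq z @ \oo --> (z^-1 * l : C).
Proof.
move=> cl; rewrite -cvg_shiftS.
pose v : nat -> C := fun n => z^-1 * Gamma_seq (z + 1) n.+1 * (1 + (z + 1) / n.+1%:R).
(* Beyond [N] the factor z + n + 2, by which the shift identity divides, cannot vanish. *)
have [N HN] : exists N : nat, `|complex.Re z| < N%:R.
  by eexists; exact: archi_boundP.
apply: (@cvgn_eq_ge C N _ v).
  move=> n Nn; apply: Gamma_seq_shift; rewrite -addrA addr_eq0 natr1.
  apply: contraTneq HN => ->.
  rewrite -natC /= normrN ger0_norm// -leNgt ler_nat.
  by rewrite (leq_trans Nn)// -addn2 leq_addr.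
rewrite -[z^-1 * l]mulr1; apply: (@cvgnM C (fun n => z^-1 * Gamma_seq (z + 1) n.+1)).
  by apply: (@cvgnMl C z^-1); rewrite cvg_shiftS.
rewrite -[X in _ --> X](addr0 (1 : C)); apply: (@cvgnD C (fun=> 1)); first exact: cvg_cst.
by rewrite -(mulr0 (z + 1)); apply: (@cvgnMl C (z + 1)); exact: cvgn_invC.
Qed.

Lemma cvg_Gamma z : Gamma_seq z @ \oo --> (Gamma z : C).
Proof.
suff [l zl] : exists l : C, Gamma_seq z @ \oo --> l by exact: cvgP zl.
elim/Re_shift_ind: z => z.
  by move=> /cvg_Gamma_seq_Re_gt0[l _ zl]; exists l.
by move=> [l /cvg_Gamma_seq_shift zl]; eexists; exact: zl.
Qed.

Lemma GammaE z (l : C) : Gamma_seq z @ \oo --> l -> (Gamma z : C) = l.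
Proof. by move=> zl; exact: (@cvgn_unique C _ _ _ (@cvg_Gamma z) zl). Qed.

(* Also at the poles: there Gamma_seq is eventually 0 and so are Gamma and its
   inverse, which makes [(Gamma z)^-1] the entire reciprocal Gamma function. *)
Lemma Gamma_shift z : Gamma z = z^-1 * Gamma (z + 1).
Proof. by apply: GammaE; apply: cvg_Gamma_seq_shift; exact: cvg_Gamma. Qed.

Lemma invGamma_shift z : (Gamma z)^-1 = z * (Gamma (z + 1))^-1.
Proof. by rewrite Gamma_shift invfM invrK. Qed.

Lemma Gamma_neq0 z : (forall m : nat, z != - m%:R) -> Gamma z != 0.
Proof.
elim/Re_shift_ind: z => z.
  by move=> /cvg_Gamma_seq_Re_gt0[l l0 /GammaE->].
move=> IH zN; rewrite Gamma_shift mulf_neq0//.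
  by rewrite invr_eq0; have := zN 0%N; rewrite oppr0.
apply: IH => m; have := zN m.+1; apply: contra_neq => h.
by rewrite -natr1 opprD -h addrK.
Qed.

Lemma neqN_shift z n : (forall m : nat, z != - m%:R) ->
  forall m : nat, z + n%:R != - m%:R.
Proof.
move=> zN m; have := zN (n + m)%N; apply: contra_neq => h.
by rewrite natrD opprD addrC -h addrK.
Qed.

Lemma Gamma_pochhammer z n : (forall m : nat, z != - m%:R) ->
  Gamma (z + n%:R) = pochhammer z n * Gamma z.
Proof.
move=> zN; elim: n => [|n IH]; first by rewrite addr0 pochhammer0 mul1r.
have zn0 : z + n%:R != 0 by rewrite addr_eq0.
rewrite pochhammerSr mulrAC -IH (Gamma_shift (z + n%:R)) mulrC mulrA.
by rewrite -addrA natr1 mulfV// mul1r.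
Qed.

End GammaFunction.

(** * Growth of Pochhammer symbols and of 1/Gamma *)

Section Asymptotics.
Context {R : realType}.
Implicit Types (p q r : nat -> R).
Local Notation C := (R[i] : numFieldType).

Definition dominated p q := exists2 c : R, 0 <= c & forall n, p n <= c * q n.

Lemma dominatedM p q p' q' : (forall n, 0 <= p n) -> (forall n, 0 <= p' n) ->
  dominated p q -> dominated p' q' -> dominated (fun n => p n * p' n) (fun n => q n * q' n).
Proof.
move=> p0 p'0 [c c0 H] [d d0 H']; exists (c * d); first exact: mulr_ge0.
by move=> n; rewrite mulrACA ler_pM.
Qed.

(** Since [q 0] is positive, the constant can absorb the first term. *)
Lemma dominated_shift p q : (forall n, 0 < q n) ->
  dominated (fun n => p n.+1) (fun n => q n.+1) -> dominated p q.
Proof.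
move=> q0 [c c0 H].
have c1 : 0 <= `|p 0%N| / q 0%N by rewrite divr_ge0// ltW.
exists (c + `|p 0%N| / q 0%N); first exact: addr_ge0.
move=> [|n]; rewrite mulrDl.
  rewrite mulfVK ?gt_eqF// (le_trans (ler_norm _))// lerDr mulr_ge0//; exact: ltW.
by rewrite (le_trans (H n))// lerDl mulr_ge0// ltW.
Qed.

Lemma dominated_cvgn p : cvgn p -> dominated p (fun=> 1).
Proof.
move=> /cvg_seq_bounded/bounded_fun_has_ubound[M pM].
exists `|M|; first exact: normr_ge0.
move=> n; rewrite mulr1 (le_trans _ (ler_norm M))//; apply: pM; by exists n.
Qed.

Lemma npow_succ n (x : R) : npow n x <= expR (`|x| * ln 2) * npow n.+1 x.
Proof. by apply: npow_comparable; lia. Qed.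

Lemma npow_pred n (x : R) : npow n.+1 x <= expR (`|x| * ln 2) * npow n x.
Proof. by apply: npow_comparable; lia. Qed.

Let fact_gt0R n : 0 < n`!%:R :> R.
Proof. by rewrite ltr0n fact_gt0. Qed.

(** Euler's limit read backwards: the sequence and its inverse are both bounded, since the limit is
    nonzero, which gives the exact order of growth. Two index shifts are made because
    [Gamma_seq z n.+1] has [pochhammer z n.+2] in its denominator; [k] compares the resulting powers
    of n + 1 and n + 3. *)
Lemma pochhammer_bounds (z : R[i]) : 0 < complex.Re z ->
  dominated (fun n => normc (pochhammer z n)) (fun n => n`!%:R * npow n (complex.Re z - 1)) /\
  dominated (fun n => n`!%:R * npow n (complex.Re z - 1)) (fun n => normc (pochhammer z n)).
Proof.
move=> z0; have zN := Re_gt0_neqN z0; set x := complex.Re z.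
have pz n : 0 < normc (pochhammer z n) by rewrite normc_gt0 pochhammer_neq0.
have fp n : 0 < n`!%:R * npow n (x - 1) by rewrite mulr_gt0 ?npow_gt0.
have [l l0 ul] := cvg_Gamma_seq_Re_gt0 z0.
have E n : normc (pochhammer z n.+2) * normc (Gamma_seq z n.+1) = n.+1`!%:R * npow n x.
  rewrite -normcM /Gamma_seq mulrC mulfVK ?pochhammer_neq0//.
  by rewrite normcM normc_nat normc_nat_cpow.
have npx n : npow n.+2 x = n.+3%:R * npow n.+2 (x - 1).
  by rewrite -npow1 -npowD; congr npow; ring.
have [B B0 HB] := dominated_cvgn (cvgP _ (cvgn_normc ul)).
have [B' B'0 HB'] : dominated (fun n => normc (Gamma_seq z n)^-1) (fun=> 1).
  apply: dominated_cvgn; apply/cvg_ex; eexists; apply: cvgn_normc.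
  exact: (@cvgnV C _ _ l0 ul).
pose k := expR (`|x| * ln 3%:R).
have k0 : 0 <= k by exact: expR_ge0.
have up n : npow n x <= k * npow n.+2 x by apply: npow_comparable; lia.
have dn n : npow n.+2 x <= k * npow n x by apply: npow_comparable; lia.
split; do 2 (apply: dominated_shift => //).
- exists (2 * k * B'); first by rewrite !mulr_ge0.
  move=> n.
  have -> : normc (pochhammer z n.+2) = n.+1`!%:R * npow n x * normc (Gamma_seq z n.+1)^-1.
    rewrite -E normcV mulfK// gt_eqF// normc_gt0.
    by rewrite !mulf_neq0 ?invr_eq0 ?nat_cpow_neq0 ?pochhammer_neq0// pnatr_eq0 -lt0n fact_gt0.
  rewrite [leRHS](_ : _ = n.+1`!%:R * (k * (2 * n.+2%:R * npow n.+2 (x - 1))) * B'); last first.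
    by rewrite (factS n.+1) natrM; ring.
  apply: ler_pM; rewrite ?mulr_ge0 ?npow_ge0 ?normc_ge0//; last by have := HB' n.+1; rewrite mulr1.
  rewrite ler_wpM2l// (le_trans (up n))// ler_wpM2l// npx ler_wpM2r ?npow_ge0//.
  by rewrite -natrM ler_nat; lia.
- exists (k * B); first by rewrite mulr_ge0.
  move=> n; apply: (@le_trans _ _ (k * (n.+1`!%:R * npow n x))).
    rewrite (factS n.+1) natrM [_ * n.+1`!%:R]mulrC -mulrA [leRHS]mulrCA ler_wpM2l//.
    by apply: le_trans (dn n); rewrite npx ler_wpM2r ?npow_ge0// ler_nat.
  rewrite -E -mulrA ler_wpM2l// mulrC ler_wpM2r ?normc_ge0//.
  by have := HB n.+1; rewrite mulr1.
Qed.

(** Only the upper bound extends to all z: at a nonpositive integer the symbol is eventually 0. *)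
Lemma dominated_pochhammer (z : R[i]) :
  dominated (fun n => normc (pochhammer z n)) (fun n => n`!%:R * npow n (complex.Re z - 1)).
Proof.
elim/(@Re_shift_ind R): z => z; first by case/pochhammer_bounds.
move=> [c c0 H]; apply: dominated_shift => [n|]; first by rewrite mulr_gt0 ?npow_gt0.
have -> : complex.Re z = complex.Re (z + 1) - 1 by case: (z) => a b /=; ring.
set x := complex.Re (z + 1) - 1 in H *.
exists (normc z * c * expR (`|x| * ln 2) * 2).
  by rewrite !mulr_ge0 ?normc_ge0 ?expR_ge0.
move=> n; rewrite pochhammerS normcM -!mulrA ler_wpM2l ?normc_ge0//.
rewrite (le_trans (H n))// ler_wpM2l// factS natrM.
rewrite [leRHS](_ : _ = n`!%:R * (expR (`|x| * ln 2) * (2 * n.+1%:R * npow n.+1 (x - 1)))); last by ring.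
rewrite ler_wpM2l// (le_trans (npow_succ n x))// ler_wpM2l ?expR_ge0//.
rewrite (npowD n.+1 x (- 1)) npowN1 mulrCA ler_peMr ?npow_ge0//.
rewrite ler_pdivlMr// mul1r -natrM ler_nat; lia.
Qed.

(** For Re g > 0 this is the lower bound in [pochhammer_bounds]. The descent merely reindexes, g +
    (k + 1) = (g + 1) + k, so poles of Gamma do no harm. *)
Lemma dominated_invGamma (g : R[i]) :
  dominated (fun k => normc (Gamma (g + k%:R))^-1)
            (fun k => npow k (1 - complex.Re g) / k`!%:R).
Proof.
elim/(@Re_shift_ind R): g => g.
  move=> g0; have gN := Re_gt0_neqN g0.
  have [_ [c c0 H]] := pochhammer_bounds g0.
  exists (c * normc (Gamma g)^-1); first by rewrite mulr_ge0 ?normc_ge0.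
  move=> k; rewrite Gamma_pochhammer// invfM normcM mulrAC ler_wpM2r ?normc_ge0//.
  rewrite normcV -[1 - _]opprB npowN -invfM.
  rewrite ler_pdivlMr ?mulr_gt0 ?npow_gt0// mulrC.
  by rewrite ler_pdivrMr ?normc_gt0 ?pochhammer_neq0// [npow _ _ * _]mulrC H.
move=> [c c0 H]; apply: dominated_shift => [n|]; first by rewrite divr_gt0 ?npow_gt0.
have e : 1 - complex.Re (g + 1) = - complex.Re g by case: (g) => a b /=; ring.
rewrite e in H; set x := complex.Re g in H *.
exists (c * expR (`|- x| * ln 2)); first by rewrite mulr_ge0 ?expR_ge0.
move=> k; rewrite -nat1r addrA (le_trans (H k))// -mulrA ler_wpM2l//.
rewrite npowD npow1 mulrA ler_pdivrMr// factS natrM.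
rewrite [leRHS](_ : _ = expR (`|- x| * ln 2) * npow k.+1 (- x) * (k.+2%:R / k.+1%:R)); last first.
  by field; rewrite nat1r !pnatr_eq0 -?lt0n ?fact_gt0.
rewrite (le_trans (npow_succ k (- x)))// ler_peMr ?mulr_ge0 ?expR_ge0 ?npow_ge0//.
by rewrite ler_pdivlMr// mul1r ler_nat.
Qed.

End Asymptotics.

(** * Gauss's summation theorem *)

Section Gauss.
Context {R : realType}.
Local Notation C := (R[i] : numFieldType).
Implicit Types a b g z : R[i].

Lemma cvgn_npow0 (x : R) : x < 0 -> npow ^~ x @ \oo --> (0 : R).
Proof.
move=> x0; apply/cvgrPdist_lt => e e0.
exists (Num.bound (expR (ln e / x))) => // n /= Nn.
rewrite sub0r normrN ger0_norm ?npow_ge0// /npow.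
rewrite -[ltRHS]lnK ?posrE// ltr_expR -ltr_ndivrMl//.
rewrite -[ltLHS](mulrC (ln e)) -[ltLHS]expRK ltr_ln ?posrE ?expR_gt0//.
rewrite (lt_le_trans (archi_boundP (expR_ge0 _)))// ler_nat.
exact: leq_trans Nn (leqnSn n).
Qed.

(* Dividing by [Gamma (g + n)] rather than by [pochhammer g n] keeps the terms
   meaningful when g is a nonpositive integer. *)
Definition gauss_term a b g n : C :=
  pochhammer a n * pochhammer b n / n`!%:R * (Gamma (g + n%:R))^-1.

Lemma dominated_gauss_term a b g :
  dominated (fun n => normc (gauss_term a b g n))
            (npow ^~ (- 1 - complex.Re (g - a - b))).
Proof.
have := dominatedM _ _ (dominatedM _ _ (dominated_pochhammer a) (dominated_pochhammer b))
          (dominated_invGamma g).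
case; do ?by move=> n; rewrite ?mulr_ge0 ?normc_ge0.
move=> c c0 H; exists c => // n.
have f0 : 0 < n`!%:R :> R by rewrite ltr0n fact_gt0.
rewrite /gauss_term !normcM normcV normc_nat mulrAC ler_pdivrMr//.
apply: (le_trans (H n)); rewrite le_eqVlt; apply/orP; left; apply/eqP.
have -> : - 1 - complex.Re (g - a - b) =
  (complex.Re a - 1) + (complex.Re b - 1) + (1 - complex.Re g).
  by case: (a) (b) (g) => ? ? [? ?] [? ?] /=; ring.
rewrite !npowD; field; exact: lt0r_neq0.
Qed.

Lemma cvg_series_gauss_term a b g : 0 < complex.Re (g - a - b) ->
  exists l : C, series (gauss_term a b g) @ \oo --> l.
Proof.
move=> h; have [c c0 H] := dominated_gauss_term a b g.
have [|l hl _] := normc_cvg_series H; last by exists l.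
by apply: cvgP; apply: cvgn_seriesZ; apply: cvg_series_npow; lra.
Qed.

(** The contiguous relation between g and g + 1, for partial sums. Each increment is a polynomial
    identity times 1/Gamma(g + N + 1), and the boundary term is O(N^(-Re(g - a - b))). *)
Lemma gauss_term_telescope a b g N :
  (g - a) * (g - b) * series (gauss_term a b (g + 1)) N
  - (g - a - b) * series (gauss_term a b g) N = N%:R * gauss_term a b g N.
Proof.
elim: N => [|N IH]; first by rewrite /series/= !big_geq// !mulr0 subrr mul0r.
rewrite !seriesSr.
have E (p q s t s' t' : R[i]) : p * (s + t) - q * (s' + t') =
  (p * s - q * s') + (p * t - q * t') by ring.
rewrite E IH /gauss_term {E IH}.
have -> : g + 1 + N%:R = g + N.+1%:R by rewrite -nat1r addrA.
rewrite (invGamma_shift (g + N%:R)) -addrA natr1 !pochhammerSr factS natrM.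
have f0 : N`!%:R != 0 :> R[i] by rewrite pnatr_eq0 -lt0n fact_gt0.
move: (pochhammer a N) (pochhammer b N) (Gamma _)^-1 (N`!%:R : R[i]) f0 => p q G f f0.
by field; rewrite f0 nat1r pnatr_eq0.
Qed.

Lemma gauss_sum_shift a b g (l l' : C) : 0 < complex.Re (g - a - b) ->
  series (gauss_term a b g) @ \oo --> l ->
  series (gauss_term a b (g + 1)) @ \oo --> l' ->
  (g - a) * (g - b) * l' = (g - a - b) * l.
Proof.
move=> h hl hl'.
apply: (@cvgn_lincomb_eq C _ _ _ _ (fun N => N%:R * gauss_term a b g N) l l' _ hl hl').
  by move=> N; exact: gauss_term_telescope.
have [c c0 H] := dominated_gauss_term a b g.
apply: (@cvgn_normc0 _ _ _ (fun n => c * npow n (- complex.Re (g - a - b)))).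
  move=> n; rewrite subr0 normcM normc_nat.
  apply: (@le_trans _ _ (n.+1%:R * (c * npow n (- 1 - complex.Re (g - a - b))))).
    by apply: ler_pM; rewrite ?normc_ge0// ler_nat.
  by rewrite mulrCA -npow1 -npowD addrA addrN add0r.
by rewrite -(mulr0 c); apply: cvgnMl; apply: cvgn_npow0; rewrite oppr_lt0.
Qed.

Lemma ler_normc_addnat z n : 0 <= complex.Re z -> normc z <= normc (z + n%:R).
Proof.
rewrite -natC; case: z => x y /= x0; rewrite addr0 ler_wsqrtr// lerD2r.
by rewrite lerXn2r ?nnegrE ?addr_ge0// lerDl.
Qed.

Lemma ler_normc_pochhammer_addnat z n m : 0 <= complex.Re z ->
  normc (pochhammer z n) <= normc (pochhammer (z + m%:R) n).
Proof.
move=> z0; elim: n => [|n IH]; first by rewrite !pochhammer0.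
rewrite !pochhammerSr !normcM ler_pM ?normc_ge0//.
rewrite addrAC ler_normc_addnat// -natC; case: (z) z0 => x y /= x0.
by rewrite addr_ge0.
Qed.

(* 2F1(a, b; g + N; 1) = 1 + O(1/N). *)
Lemma gauss_sum_asymptotic a b g : 0 < complex.Re g -> 0 < complex.Re (g - a - b) ->
  exists2 K : R, 0 <= K & forall N (l : C),
    series (gauss_term a b (g + N.+1%:R)) @ \oo --> l ->
    normc (l * Gamma (g + N.+1%:R) - 1) <= K / N.+1%:R.
Proof.
move=> g0 gab; have gN := Re_gt0_neqN g0.
have [c c0 H] := dominated_gauss_term a b g.
set x := - 1 - complex.Re (g - a - b) in H *.
have cx : cvgn (series (npow ^~ x)) by apply: cvg_series_npow; rewrite /x; lra.
have L0 : 0 <= limn (series (npow ^~ x)).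
  have := @series_le_lim _ _ 0 (fun n => npow_ge0 n x) cx.
  by rewrite {1}/series/= big_geq.
pose D := normc (Gamma g) * normc g * (c * expR (`|x| * ln 2)).
have D0 : 0 <= D by rewrite !mulr_ge0 ?normc_ge0 ?expR_ge0.
exists (D * limn (series (npow ^~ x))); first exact: mulr_ge0.
move=> N l hl.
have gNN := neqN_shift N.+1 gN.
pose v n : C := gauss_term a b (g + N.+1%:R) n * Gamma (g + N.+1%:R).
have vE n : v n = pochhammer a n * pochhammer b n / n`!%:R / pochhammer (g + N.+1%:R) n.
  by rewrite /v /gauss_term Gamma_pochhammer// invfM mulrA mulfVK// Gamma_neq0.
have hv : series v @ \oo --> (l * Gamma (g + N.+1%:R) : C).
  have -> : v = fun n => Gamma (g + N.+1%:R) * gauss_term a b (g + N.+1%:R) n.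
    by apply/funext => n; rewrite /v mulrC.
  by rewrite mulrC; exact: (@cvgn_seriesZ C).
(* The first factor of (g + N + 1)_(n+1) supplies 1/(N + 1). The other factors dominate (g + 1)_n,
   which leaves a Gauss term at g up to the factor |g| |Gamma g|. *)
have vx n : normc (v n.+1 : R[i]) <= D / N.+1%:R * npow n x.
  have -> : D / N.+1%:R * npow n x = normc (Gamma g) * normc g / N.+1%:R *
      (c * (expR (`|x| * ln 2) * npow n x)) by rewrite /D; ring.
  apply: (@le_trans _ _ (normc (Gamma g) * normc g / N.+1%:R *
                         normc (gauss_term a b g n.+1))); last first.
    rewrite ler_wpM2l ?mulr_ge0 ?normc_ge0 ?invr_ge0//.
    by rewrite (le_trans (H _))// ler_wpM2l// npow_pred.
  rewrite vE /gauss_term Gamma_pochhammer// invfM mulrA.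
  move: (pochhammer a n.+1 * pochhammer b n.+1 / n.+1`!%:R) => A.
  rewrite !normcM !normcV.
  rewrite [leRHS](_ : _ = normc A * (normc g / N.+1%:R / normc (pochhammer g n.+1))); last first.
    by field; rewrite nat1r pnatr_eq0/= !normc_eq0 pochhammer_neq0// Gamma_neq0.
  rewrite ler_wpM2l ?normc_ge0// !pochhammerS !normcM invfM.
  have g1 : 0 < normc g by rewrite normc_gt0; have := gN 0%N; rewrite oppr0.
  have pg m : 0 < normc (pochhammer (g + m%:R + 1) n).
    rewrite normc_gt0 pochhammer_neq0// => k; rewrite -addrA natr1.
    exact: neqN_shift.
  have -> : normc g / N.+1%:R / (normc g * normc (pochhammer (g + 1) n)) =
     N.+1%:R^-1 * (normc (pochhammer (g + 1) n))^-1.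
    by have := pg 0%N; rewrite addr0 => pg0; field; rewrite nat1r pnatr_eq0 !gt_eqF.
  have gN0 : N.+1%:R <= normc (g + N.+1%:R).
    rewrite (le_trans _ (ler_Re_normc _))// (le_trans _ (ler_norm _))//.
    by rewrite -natC; case: (g) g0 => p q /= p0; rewrite lerDr ltW.
  apply: ler_pM; rewrite ?invr_ge0 ?normc_ge0//.
    by rewrite lef_pV2// posrE// (lt_le_trans _ gN0).
  have := pg 0%N; rewrite addr0 => pg0; rewrite lef_pV2 ?posrE// addrAC.
  apply: ler_normc_pochhammer_addnat; case: (g) g0 => p q /= p0.
  by rewrite addr_ge0// ltW.
have [|l' hl' lx] := normc_cvg_series vx.
  by apply: cvgP; apply: cvgn_seriesZ; exact: cx.
have /cvgn_unique : series v @ \oo --> (v 0%N + l' : C) by exact: cvgn_series_recl.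
move=> /(_ _ hv) <-; rewrite vE !pochhammer0 fact0 mulr1 !divr1 addrC addKr.
have := lx 0%N; rewrite {1 3}/series/= !big_geq// !subr0 => /le_trans; apply.
rewrite (cvg_lim _ (@cvgn_seriesZ R (D / N.+1%:R) _ _ cx))//.
by rewrite mulrAC.
Qed.

(** Iterating the contiguous relation expresses [l] through Pochhammer quotients times the sum at g
    + n, and the latter times Gamma(g + n) tends to 1. The quotients become Euler sequences; their
    powers of n cancel because (g - a - b) + g = (g - a) + (g - b). *)
Lemma gauss_sum_Re_gt0 a b g (l : C) :
  0 < complex.Re g -> 0 < complex.Re (g - a) -> 0 < complex.Re (g - b) ->
  0 < complex.Re (g - a - b) -> series (gauss_term a b g) @ \oo --> l ->
  l = Gamma (g - a - b) / (Gamma (g - a) * Gamma (g - b)).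
Proof.
move=> g0 ga0 gb0 gab0 gl.
have gN := Re_gt0_neqN g0; have gaN := Re_gt0_neqN ga0.
have gbN := Re_gt0_neqN gb0; have gabN := Re_gt0_neqN gab0.
have ReD n : 0 < complex.Re (g + n%:R - a - b).
  move: gab0; rewrite -natC; case: (g) (a) (b) => ? ? [? ?] [? ?] /=.
  by have := ler0n R n; lra.
have /choice[L HL] n : exists l : C, series (gauss_term a b (g + n%:R)) @ \oo --> l.
  exact: cvg_series_gauss_term.
have L0 : L 0%N = l.
  by apply: (@cvgn_unique C _ _ _ _ gl); have := HL 0%N; rewrite addr0.
have rec n : pochhammer (g - a) n * pochhammer (g - b) n * L n = pochhammer (g - a - b) n * l.
  elim: n => [|n IH]; first by rewrite !pochhammer0 L0 !mul1r.
  have HS : series (gauss_term a b (g + n%:R + 1)) @ \oo --> L n.+1.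
    by rewrite -addrA natr1; exact: HL.
  have E := gauss_sum_shift (ReD n) (HL n) HS.
  rewrite !pochhammerSr.
  have -> : pochhammer (g - a - b) n * (g - a - b + n%:R) * l =
     (pochhammer (g - a - b) n * l) * (g + n%:R - a - b) by ring.
  rewrite -IH.
  have -> : pochhammer (g - a) n * pochhammer (g - b) n * L n * (g + n%:R - a - b) =
     pochhammer (g - a) n * pochhammer (g - b) n * ((g + n%:R - a - b) * L n) by ring.
  by rewrite -E; ring.
have [K K0 HK] := gauss_sum_asymptotic g0 gab0.
have Llim : (fun n => L n.+2 * Gamma (g + n.+2%:R) : C) @ \oo --> (1 : C).
  apply: (@cvgn_normc0 _ _ _ (fun n => K * n.+1%:R^-1)).
    move=> n; rewrite (le_trans (HK _ _ (HL n.+2)))// ler_wpM2l//.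
    by rewrite lef_pV2 ?posrE// ler_nat.
  by rewrite -(mulr0 K); apply: cvgnMl; exact: cvg_harmonic.
have sh z : (fun n => Gamma_seq z n.+1) @ \oo --> (Gamma z : C).
  by rewrite cvg_shiftS; exact: cvg_Gamma.
have lim1 := @cvgnM C _ _ _ _ (@cvgnM C _ _ _ _ (sh (g - a - b)) (sh g))
  (@cvgnV C _ _ (mulf_neq0 (Gamma_neq0 gaN) (Gamma_neq0 gbN))
    (@cvgnM C _ _ _ _ (sh (g - a)) (sh (g - b)))).
have lim2 := @cvgnM C _ _ _ _ lim1 Llim.
have G0 := Gamma_neq0 gN.
(* The sequence in [lim2] is in fact constant, equal to [l * Gamma g] by [rec]. The index n + 2 in
   [Llim] matches the n + 2 denominator factors of [Gamma_seq _ n.+1]. *)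
apply: (mulIf G0); apply: (@cvgn_unique C (fun=> l * Gamma g)); first exact: cvgn_cst.
have -> : Gamma (g - a - b) / (Gamma (g - a) * Gamma (g - b)) * Gamma g =
   Gamma (g - a - b) * Gamma g / (Gamma (g - a) * Gamma (g - b)) * 1 by ring.
apply: (@cvgn_eq_ge C 0) lim2 => n _.
rewrite Gamma_pochhammer// /Gamma_seq.
have ge0 := nat_cpow_neq0 n.+1 (g - a); have gf0 := nat_cpow_neq0 n.+1 (g - b).
have -> : nat_cpow n.+1 (g - a - b) =
    nat_cpow n.+1 (g - a) * nat_cpow n.+1 (g - b) / nat_cpow n.+1 g.
  by rewrite -nat_cpowD -[LHS](mulfK (nat_cpow_neq0 n.+1 g)) -nat_cpowD; congr (nat_cpow _ _ / _); ring.
have {}rec := rec n.+2; have c0 := nat_cpow_neq0 n.+1 g.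
have p1 := pochhammer_neq0 n.+2 gN; have p2 := pochhammer_neq0 n.+2 gaN.
have p3 := pochhammer_neq0 n.+2 gbN; have p4 := pochhammer_neq0 n.+2 gabN.
have f0 : n.+1`!%:R != 0 :> R[i] by rewrite pnatr_eq0 -lt0n fact_gt0.
have -> : l = pochhammer (g - a) n.+2 * pochhammer (g - b) n.+2 * L n.+2 / pochhammer (g - a - b) n.+2.
  by rewrite rec mulrC mulKf.
move: ge0 gf0 c0 p1 p2 p3 p4 f0.
move: (nat_cpow _ _) (nat_cpow _ _) (nat_cpow _ _) (pochhammer _ _) (pochhammer _ _)
  (pochhammer _ _) (pochhammer _ _) (n.+1`!%:R : R[i]) (L n.+2) (Gamma g)
  => q1 q2 q3 p1 p2 p3 p4 f LL G h1 h2 h3 h4 h5 h6 h7 h8.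
by field; rewrite h1 h2 h3 h4 h5 h6 h7 h8.
Qed.

Lemma cvg_gauss_sum a b g : 0 < complex.Re (g - a - b) ->
  series (gauss_term a b g) @ \oo -->
  (Gamma (g - a - b) / (Gamma (g - a) * Gamma (g - b)) : C).
Proof.
(* Shifting by [M] makes the base case Re(g - M) > 0 imply that g, g - a and g - b all have positive
   real part. The descent divides only by g - a - b; zeros of g - a or g - b are harmless in the
   reciprocal Gamma factors. *)
pose M := (`|complex.Re a| + `|complex.Re b|)%:C.
rewrite -[g](subrK M); elim/(@Re_shift_ind R): (g - M) => {g} z.
  move=> z0 h; have [l hl] := cvg_series_gauss_term h.
  have a1 := ler_norm (complex.Re a); have b1 := ler_norm (complex.Re b).
  have a2 := normr_ge0 (complex.Re a); have b2 := normr_ge0 (complex.Re b).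
  rewrite -(gauss_sum_Re_gt0 _ _ _ h hl)//; move: z0 a1 a2 b1 b2 {h hl}.
  - by rewrite /M; case: z => p q; case: (a) (b) => ? ? [? ?] /=; lra.
  - by rewrite /M; case: z => p q; case: (a) (b) => ? ? [? ?] /=; lra.
  - by rewrite /M; case: z => p q; case: (a) (b) => ? ? [? ?] /=; lra.
have -> : z + 1 + M = (z + M) + 1 by ring.
move: (z + M) => g IH h; have [l hl] := cvg_series_gauss_term h.
have e1 : g + 1 - a - b = (g - a - b) + 1 by ring.
have {IH}hS : series (gauss_term a b (g + 1)) @ \oo -->
    (Gamma (g + 1 - a - b) / (Gamma (g + 1 - a) * Gamma (g + 1 - b)) : C).
  apply: IH; rewrite e1; move: h; move: (g - a - b) => [p q] /=; lra.
have E := gauss_sum_shift h hl hS.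
have w0 : g - a - b != 0 by have := Re_gt0_neqN h 0%N; rewrite oppr0.
rewrite (_ : _ / _ = l)//; apply: (mulfI w0); rewrite -E e1.
have -> : g + 1 - a = (g - a) + 1 by ring.
have -> : g + 1 - b = (g - b) + 1 by ring.
rewrite (Gamma_shift (g - a - b)) !invfM (invGamma_shift (g - a)) (invGamma_shift (g - b)).
by move: (Gamma _)^-1 (Gamma _)^-1 => p q; rewrite !mulrA divff// mul1r; ring.
Qed.

End Gauss.

(** * Thomae's transformation *)

Section Thomae.
Context {R : realType}.
Local Notation C := (R[i] : numFieldType).
Implicit Types a b c d e g p q s : R[i].

(* For n <= m the binomial coefficient of n + m over n is at least 2^n, which
   absorbs every power of n; this makes the double series absolutely
   convergent. *)
Lemma exp2_fact_le n m : (n <= m)%N -> (2 ^ n * (n`! * m`!) <= (n + m)`!)%N.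
Proof.
elim: n => [|n IH] nm; first by rewrite mul1n fact0 mul1n.
have {}IH := IH (ltnW nm); rewrite addSn !factS expnS.
rewrite (_ : (_ * _ = (2 * n.+1) * (2 ^ n * (n`! * m`!)))%N); last by ring.
by apply: leq_mul => //; lia.
Qed.

Lemma fact_npow_bound (A B y : R) : exists2 K : R, 0 <= K & forall n m, (n <= m)%N ->
  (n`!%:R * npow n A) * (m`!%:R * npow m B) * (npow (n + m) y / (n + m)`!%:R)
  <= K * (npow n (- 2) * npow m (B + y)).
Proof.
(* With A + 2 instead of A, the factor 2^n absorbs n^(A+2) and the summable n^(-2) is left over. *)
have [c c0 H] := npow_le_exp2 (A + 2).
exists (c * expR (`|y| * ln 2)); first by rewrite mulr_ge0 ?expR_ge0.
move=> n m nm.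
have f0 k : 0 < k`!%:R :> R by rewrite ltr0n fact_gt0.
have h1 : npow (n + m) y <= expR (`|y| * ln 2) * npow m y.
  by apply: npow_comparable; lia.
have h2 : n`!%:R * m`!%:R / (n + m)`!%:R <= (2 ^+ n)^-1 :> R.
  rewrite ler_pdivrMr// [leRHS]mulrC ler_pdivlMr ?exprn_gt0// -natrX -!natrM ler_nat.
  by rewrite mulnC exp2_fact_le.
have h3 : npow n A <= c * 2 ^+ n * npow n (- 2).
  have -> : A = (A + 2) + - 2 by ring.
  by rewrite npowD ler_wpM2r ?npow_ge0.
rewrite [leLHS](_ : _ = (npow n A * npow (n + m) y) * (n`!%:R * m`!%:R / (n + m)`!%:R) * npow m B); last first.
  by field; exact: lt0r_neq0.
rewrite npowD [leRHS](_ : _ = (c * 2 ^+ n * npow n (- 2) * (expR (`|y| * ln 2) * npow m y)) * (2 ^+ n)^-1 * npow m B); last first.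
  by field; rewrite lt0r_neq0// exprn_gt0.
rewrite ler_wpM2r ?npow_ge0//; apply: ler_pM => //.
- by rewrite mulr_ge0 ?npow_ge0.
- by apply: ler_pM; rewrite ?npow_ge0.
Qed.

(** The larger index keeps the exponent of its own Gauss series, the smaller one gets -2. Adding the
    bounds for n <= m and m <= n covers all index pairs. *)
Lemma double_series_bound a b p q g : exists2 K : R, 0 <= K & forall n m,
  normc (pochhammer a n * pochhammer b n / n`!%:R * gauss_term p q (g + n%:R) m : R[i]) <=
  K * npow n (- 2) * npow m (- 1 - complex.Re (g - p - q)) +
  K * npow n (- 1 - complex.Re (g - a - b)) * npow m (- 2).
Proof.
have f0 k : 0 < k`!%:R :> R by rewrite ltr0n fact_gt0.
have [ca ca0 Ha] := dominated_pochhammer a; have [cb cb0 Hb] := dominated_pochhammer b.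
have [cp cp0 Hp] := dominated_pochhammer p; have [cq cq0 Hq] := dominated_pochhammer q.
have [cg cg0 Hg] := dominated_invGamma g.
pose A := complex.Re a - 1 + (complex.Re b - 1).
pose B := complex.Re p - 1 + (complex.Re q - 1).
pose y := 1 - complex.Re g.
have [K1 K10 H1] := fact_npow_bound A B y.
have [K2 K20 H2] := fact_npow_bound B A y.
pose M := ca * cb * cp * cq * cg.
have M0 : 0 <= M by rewrite !mulr_ge0.
exists (M * (K1 + K2)); first by rewrite mulr_ge0// addr_ge0.
move=> n m.
have T : normc (pochhammer a n * pochhammer b n / n`!%:R * gauss_term p q (g + n%:R) m : R[i]) <=
  M * ((n`!%:R * npow n A) * (m`!%:R * npow m B) * (npow (n + m) y / (n + m)`!%:R)).
  rewrite /gauss_term -addrA -natrD !normcM !normcV !normc_nat.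
  rewrite [leRHS](_ : _ =
    (ca * (n`!%:R * npow n (complex.Re a - 1))) * (cb * (n`!%:R * npow n (complex.Re b - 1))) / n`!%:R *
    ((cp * (m`!%:R * npow m (complex.Re p - 1))) * (cq * (m`!%:R * npow m (complex.Re q - 1))) / m`!%:R *
    (cg * (npow (n + m) y / (n + m)`!%:R)))); last first.
    by rewrite /M /A /B !npowD; field; rewrite !lt0r_neq0.
  have i0 k : 0 <= k`!%:R^-1 :> R by rewrite invr_ge0 ltW.
  do ?[apply: ler_pM => //]; rewrite ?mulr_ge0 ?normc_ge0 ?invr_ge0 ?normc_ge0//.
  by have := Hg (n + m)%N; rewrite normcV.
have e1 : - 1 - complex.Re (g - p - q) = B + y.
  by rewrite /B /y; case: (g) (p) (q) => ? ? [? ?] [? ?] /=; ring.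
have e2 : - 1 - complex.Re (g - a - b) = A + y.
  by rewrite /A /y; case: (g) (a) (b) => ? ? [? ?] [? ?] /=; ring.
rewrite e1 e2; apply: (le_trans T); clear T e1 e2; clearbody M A B y.
have X0 : 0 <= npow n (- 2) * npow m (B + y) by rewrite mulr_ge0 ?npow_ge0.
have Y0 : 0 <= npow n (A + y) * npow m (- 2) by rewrite mulr_ge0 ?npow_ge0.
rewrite -!mulrA -!mulrDr ler_wpM2l// mulrDl.
have [nm|/ltnW mn] := leqP n m.
- have := H1 _ _ nm; rewrite -!mulrA => /le_trans; apply.
  rewrite mulrDr; have := mulr_ge0 K10 Y0; have := mulr_ge0 K20 X0; have := mulr_ge0 K20 Y0; lra.
- rewrite [leLHS](_ : _ = (m`!%:R * npow m B) * (n`!%:R * npow n A) * (npow (m + n) y / (m + n)`!%:R)); last first.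
    by rewrite [(m + n)%N]addnC; ring.
  have := H2 _ _ mn => /le_trans; apply.
  rewrite [npow m _ * _]mulrC mulrDr.
  have := mulr_ge0 K10 Y0; have := mulr_ge0 K20 X0; have := mulr_ge0 K10 X0; lra.
Qed.

Lemma cvg_double_gauss a b p q g :
  0 < complex.Re (g - a - b) -> 0 < complex.Re (g - p - q) ->
  exists2 l : C,
    series (fun n => pochhammer a n * pochhammer b n / n`!%:R *
      (Gamma (g + n%:R - p - q) / (Gamma (g + n%:R - p) * Gamma (g + n%:R - q))) : C) @ \oo --> l &
    series (fun m => pochhammer p m * pochhammer q m / m`!%:R *
      (Gamma (g + m%:R - a - b) / (Gamma (g + m%:R - a) * Gamma (g + m%:R - b))) : C) @ \oo --> l.
Proof.
move=> gab gpq.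
have ReD (x y : R[i]) n : 0 < complex.Re (g - x - y) -> 0 < complex.Re (g + n%:R - x - y).
  rewrite -natC; case: (g) x y => ? ? [? ?] [? ?] /=.
  by have := ler0n R n; lra.
have [K K0 HK] := double_series_bound a b p q g.
apply: (cvg_series_swap
  (u := fun n m => pochhammer a n * pochhammer b n / n`!%:R * gauss_term p q (g + n%:R) m)
  _ _ _ _ _ _ _ _ HK).
- by move=> n; rewrite mulr_ge0 ?npow_ge0.
- by move=> n; exact: npow_ge0.
- by move=> n; rewrite mulr_ge0 ?npow_ge0.
- by move=> n; exact: npow_ge0.
- by apply: cvgP; apply: cvgn_seriesZ; apply: cvg_series_npow; lra.
- by apply: cvg_series_npow; lra.
- by apply: cvgP; apply: cvgn_seriesZ; apply: cvg_series_npow; lra.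
- by apply: cvg_series_npow; lra.
- move=> n; apply: (@cvgn_seriesZ C); apply: cvg_gauss_sum; exact: ReD.
- move=> m.
  have -> : (fun n => pochhammer a n * pochhammer b n / n`!%:R * gauss_term p q (g + n%:R) m) =
    (fun n => pochhammer p m * pochhammer q m / m`!%:R * gauss_term a b (g + m%:R) n).
    by apply/funext => n; rewrite /gauss_term -!addrA [n%:R + _]addrC; ring.
  apply: (@cvgn_seriesZ C); apply: cvg_gauss_sum; exact: ReD.
Qed.

Definition term3F2 a b c d e n : C :=
  pochhammer a n * pochhammer b n * pochhammer c n /
  (pochhammer d n * pochhammer e n * n`!%:R).

(** Here [l] is the double sum; leaving it explicit makes the later recombination linear in three
    such unknowns. Re s > 0 and Re c > 0 are the convergence conditions of the two inner Gauss
    sums. *)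
Lemma thomae a b c d e s : s = d + e - a - b - c ->
  0 < complex.Re s -> 0 < complex.Re c ->
  (forall n : nat, d != - n%:R) -> (forall n : nat, e != - n%:R) ->
  (forall n : nat, s + a != - n%:R) -> (forall n : nat, s + b != - n%:R) ->
  exists2 l : C,
    series (term3F2 a b c d e) @ \oo --> (Gamma d * Gamma e / Gamma c * l : C) &
    series (term3F2 s (e - c) (d - c) (s + a) (s + b)) @ \oo -->
      (Gamma (s + a) * Gamma (s + b) / Gamma s * l : C).
Proof.
move=> sE s0 c0 dN eN saN sbN.
pose g := d + e - c.
have sE' : g - a - b = s by rewrite /g sE; ring.
have cE' : g - (e - c) - (d - c) = c by rewrite /g; ring.
have cN := Re_gt0_neqN c0; have sN := Re_gt0_neqN s0.
have [||l h1 h2] := @cvg_double_gauss a b (e - c) (d - c) g; rewrite ?sE' ?cE'//.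
exists l.
- rewrite [X in series X](_ : _ = fun n => Gamma d * Gamma e / Gamma c *
    (pochhammer a n * pochhammer b n / n`!%:R *
      (Gamma (g + n%:R - (e - c) - (d - c)) / (Gamma (g + n%:R - (e - c)) * Gamma (g + n%:R - (d - c)))))).
    exact: (@cvgn_seriesZ C).
  apply/funext => n.
  have -> : g + n%:R - (e - c) - (d - c) = c + n%:R by rewrite /g; ring.
  have -> : g + n%:R - (e - c) = d + n%:R by rewrite /g; ring.
  have -> : g + n%:R - (d - c) = e + n%:R by rewrite /g; ring.
  rewrite !Gamma_pochhammer// /term3F2.
  have := Gamma_neq0 dN; have := Gamma_neq0 eN; have := Gamma_neq0 cN.
  have := pochhammer_neq0 n dN; have := pochhammer_neq0 n eN.
  have : n`!%:R != 0 :> R[i] by rewrite pnatr_eq0 -lt0n fact_gt0.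
  move: (Gamma d) (Gamma e) (Gamma c) (pochhammer d n) (pochhammer e n) (n`!%:R : R[i]).
  by move=> x1 x2 x3 x4 x5 x6 y1 y2 y3 y4 y5 y6; field; rewrite y1 y2 y3 y4 y5 y6.
- rewrite [X in series X](_ : _ = fun n => Gamma (s + a) * Gamma (s + b) / Gamma s *
    (pochhammer (e - c) n * pochhammer (d - c) n / n`!%:R *
      (Gamma (g + n%:R - a - b) / (Gamma (g + n%:R - a) * Gamma (g + n%:R - b))))).
    exact: (@cvgn_seriesZ C).
  apply/funext => n.
  have -> : g + n%:R - a - b = s + n%:R by rewrite /g sE; ring.
  have -> : g + n%:R - a = s + b + n%:R by rewrite /g sE; ring.
  have -> : g + n%:R - b = s + a + n%:R by rewrite /g sE; ring.
  rewrite !Gamma_pochhammer// /term3F2.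
  have := Gamma_neq0 saN; have := Gamma_neq0 sbN; have := Gamma_neq0 sN.
  have := pochhammer_neq0 n saN; have := pochhammer_neq0 n sbN.
  have : n`!%:R != 0 :> R[i] by rewrite pnatr_eq0 -lt0n fact_gt0.
  move: (Gamma (s + a)) (Gamma (s + b)) (Gamma s) (pochhammer (s + a) n) (pochhammer (s + b) n) (n`!%:R : R[i]).
  by move=> x1 x2 x3 x4 x5 x6 y1 y2 y3 y4 y5 y6; field; rewrite y1 y2 y3 y4 y5 y6.
Qed.

End Thomae.

(** * Reduction of the 5F4 series *)

Section Reduction.
Context {R : realType}.
Local Notation C := (R[i] : numFieldType).
Implicit Types a b c d e f h s : R[i].

Lemma pochhammer_succ_div (x : R[i]) n : (forall m : nat, x != - m%:R) ->
  pochhammer (x + 1) n / pochhammer x n = (x + n%:R) / x.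
Proof.
move=> xN; have x0 : x != 0 by have := xN 0%N; rewrite oppr0.
have p0 := pochhammer_neq0 n xN.
apply/eqP; rewrite eqr_div//; apply/eqP.
by rewrite mulrC -pochhammerS pochhammerSr mulrC.
Qed.

(** In the Newton basis 1, x, x (x - 1) the numerators are the coefficients with which the three 3F2
    series enter f h times the left-hand side. This is what [eta] is made for: (h - c - 1)(eta +
    2)/eta = f - c and 2 (h - c - 1)(eta + 1)/eta = h + f - 2c - 1. *)
Lemma P2_evalE c d e f h eta x : h - f - 1 != 0 ->
  eta = - 2 * (h - c - 1) / (h - f - 1) -> eta != 0 -> eta != - 1 ->
  e - c - 2 != 0 -> e - c - 2 != - 1 -> d - c - 2 != 0 -> d - c - 2 != - 1 ->
  P2_eval c d e h eta x =
    1 + (h + f - 2 * c - 1) / ((e - c - 2) * (d - c - 2)) * x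
      + (h - c) * (f - c) / (((e - c - 2) * (e - c - 1)) * ((d - c - 2) * (d - c - 1)))
        * (x * (x - 1)).
Proof.
move=> hf0 etaE eta0 eta1 e0 e1 d0 d1.
rewrite /P2_eval !big_ord_recl big_ord0 /hypergeometric_term /pochhammer !big_cons !big_nil.
rewrite !big_ord_recl !big_ord0 /= /bump/= !addr0 !mulr1 !expr1n.
have hc0 : h - c - 1 != 0.
  by move: eta0; rewrite etaE; apply: contra_neq => ->; rewrite mulr0 mul0r.
have e1' : e - c - 1 != 0.
  by move: e1; apply: contra_neq => H; rewrite -[RHS]add0r -H; ring.
have d1' : d - c - 1 != 0.
  by move: d1; apply: contra_neq => H; rewrite -[RHS]add0r -H; ring.
have eta1' : eta + 1 != 0 by rewrite addr_eq0.
have -> : f = h - 1 + 2 * (h - c - 1) / eta.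
  by rewrite etaE; field; rewrite hf0 hc0.
have -> : e - c - 1 = (e - c - 2) + 1 by ring.
have -> : d - c - 1 = (d - c - 2) + 1 by ring.
have -> : h = (h - c - 1) + c + 1 by ring.
have e2 : e - c - 2 + 1 != 0 by rewrite addr_eq0.
have d2 : d - c - 2 + 1 != 0 by rewrite addr_eq0.
have -> : h - c - 1 + c + 1 - c - 1 = h - c - 1 by ring.
move: (e - c - 2) (d - c - 2) (h - c - 1) e0 e2 d0 d2 => p q w p0 p1 q0 q1.
rewrite (_ : (1 + (1 + 0))%N = 2%N)// (_ : (1 + 0)%N = 1%N)// (_ : 0`! = 1%N)//.
rewrite (_ : 1`! = 1%N)// (_ : 2`! = 2%N)//.
by field; rewrite p0 p1 q0 q1 eta0 eta1'.
Qed.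

Lemma series_fxh a b c d e f h (l0 l1 l2 : C) :
  (forall n : nat, d != - n%:R) -> (forall n : nat, e != - n%:R) ->
  (forall n : nat, f != - n%:R) -> (forall n : nat, h != - n%:R) ->
  series (term3F2 a b c d e) @ \oo --> l0 ->
  series (term3F2 a b (c + 1) d e) @ \oo --> l1 ->
  series (term3F2 a b (c + 2) d e) @ \oo --> l2 ->
  series (hypergeometric_term [:: a; b; c; f + 1; h + 1] [:: d; e; f; h] 1 : nat -> C) @ \oo -->
    ((f * h)^-1 * (c * (c + 1) * l2 + ((f + h - 2 * c - 1) * c * l1
      + (f - c) * (h - c) * l0)) : C).
Proof.
move=> dN eN fN hN h0 h1 h2.
have := @cvgn_seriesZ C (f * h)^-1 _ _ (@cvgn_seriesD C _ _ _ _
  (@cvgn_seriesZ C (c * (c + 1)) _ _ h2) (@cvgn_seriesD C _ _ _ _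
  (@cvgn_seriesZ C ((f + h - 2 * c - 1) * c) _ _ h1) (@cvgn_seriesZ C ((f - c) * (h - c)) _ _ h0))).
rewrite [X in series X @ _ --> _ -> _](_ : _ =
  hypergeometric_term [:: a; b; c; f + 1; h + 1] [:: d; e; f; h] 1)//.
apply/funext => n.
rewrite /hypergeometric_term !big_cons !big_nil !mulr1 expr1n mul1r.
have f0 : f != 0 by have := fN 0%N; rewrite oppr0.
have hh0 : h != 0 by have := hN 0%N; rewrite oppr0.
rewrite [RHS](_ : _ = pochhammer a n * pochhammer b n * pochhammer c n /
   (pochhammer d n * pochhammer e n * n`!%:R) *
   (pochhammer (f + 1) n / pochhammer f n) * (pochhammer (h + 1) n / pochhammer h n)); last first.
  by rewrite !invfM; ring.
rewrite !pochhammer_succ_div//.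
have E1 : c * pochhammer (c + 1) n = pochhammer c n * (c + n%:R).
  by rewrite -pochhammerS pochhammerSr.
have E2 : c * (c + 1) * pochhammer (c + 2) n = pochhammer c n * (c + n%:R) * (c + n%:R + 1).
  rewrite (_ : c + 2 = c + 1 + 1); last by ring.
  by rewrite -mulrA -!pochhammerS !pochhammerSr -addrA natr1.
rewrite /term3F2.
rewrite [LHS](_ : _ = (f * h)^-1 * (pochhammer a n * pochhammer b n /
   (pochhammer d n * pochhammer e n * n`!%:R)) *
   (c * (c + 1) * pochhammer (c + 2) n + (f + h - 2 * c - 1) * (c * pochhammer (c + 1) n)
     + (f - c) * (h - c) * pochhammer c n)); last by ring.
rewrite E1 E2.
have := pochhammer_neq0 n dN; have := pochhammer_neq0 n eN.
have : n`!%:R != 0 :> R[i] by rewrite pnatr_eq0 -lt0n fact_gt0.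
move: (pochhammer a n) (pochhammer b n) (pochhammer c n) (pochhammer d n) (pochhammer e n)
  (n`!%:R : R[i]) (n%:R : R[i]).
move=> x1 x2 x3 x4 x5 x6 x7 y1 y2 y3.
by field; rewrite f0 hh0 y1 y2 y3.
Qed.

(** The weight n kills the term at 0 and reduces n! to (n - 1)!, so an index shift raises all five
    parameters by 1. *)
Lemma series_natmul_term3F2 a b c d e (l : C) :
  (forall n : nat, d != - n%:R) -> (forall n : nat, e != - n%:R) ->
  series (term3F2 (a + 1) (b + 1) (c + 1) (d + 1) (e + 1)) @ \oo --> l ->
  series (fun n => n%:R * term3F2 a b c d e n) @ \oo --> (a * b * c / (d * e) * l : C).
Proof.
move=> dN eN hl; apply: (@cvgn_series_shift C _ _ _ _ _ (@cvgn_seriesZ C _ _ _ hl)).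
  by rewrite mul0r.
move=> n; rewrite /term3F2 !pochhammerS factS natrM.
have d0 : d != 0 by have := dN 0%N; rewrite oppr0.
have e0 : e != 0 by have := eN 0%N; rewrite oppr0.
have := pochhammer_neq0 n (neqN_shift 1 dN); have := pochhammer_neq0 n (neqN_shift 1 eN).
have : n`!%:R != 0 :> R[i] by rewrite pnatr_eq0 -lt0n fact_gt0.
have : n.+1%:R != 0 :> R[i] by rewrite pnatr_eq0.
move: (pochhammer (a + 1) n) (pochhammer (b + 1) n) (pochhammer (c + 1) n)
  (pochhammer (d + 1) n) (pochhammer (e + 1) n) (n`!%:R : R[i]) (n.+1%:R : R[i]).
move=> x1 x2 x3 x4 x5 x6 x7 y1 y2 y3 y4.
by field; rewrite d0 e0 y1 y2 y3 y4.
Qed.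

Lemma series_natmul2_term3F2 a b c d e (l : C) :
  (forall n : nat, d != - n%:R) -> (forall n : nat, e != - n%:R) ->
  series (term3F2 (a + 2) (b + 2) (c + 2) (d + 2) (e + 2)) @ \oo --> l ->
  series (fun n => n%:R * (n%:R - 1) * term3F2 a b c d e n) @ \oo -->
    ((a * (a + 1)) * (b * (b + 1)) * (c * (c + 1)) / ((d * (d + 1)) * (e * (e + 1))) * l : C).
Proof.
move=> dN eN hl.
have e2 (x : R[i]) : x + 2 = x + 1 + 1 by ring.
rewrite !e2 in hl.
have hl1 := series_natmul_term3F2 (neqN_shift 1 dN) (neqN_shift 1 eN) hl.
have := @cvgn_seriesZ C (a * b * c / (d * e)) _ _ hl1.
rewrite [X in _ --> X -> _](_ : _ =
  (a * (a + 1)) * (b * (b + 1)) * (c * (c + 1)) / ((d * (d + 1)) * (e * (e + 1))) * l); last first.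
  by rewrite !invfM; ring.
apply: cvgn_series_shift; first by rewrite !mul0r.
move=> n; rewrite /term3F2 !pochhammerS factS natrM.
have d0 : d != 0 by have := dN 0%N; rewrite oppr0.
have e0 : e != 0 by have := eN 0%N; rewrite oppr0.
have := pochhammer_neq0 n (neqN_shift 1 dN); have := pochhammer_neq0 n (neqN_shift 1 eN).
have : n`!%:R != 0 :> R[i] by rewrite pnatr_eq0 -lt0n fact_gt0.
have : n.+1%:R != 0 :> R[i] by rewrite pnatr_eq0.
rewrite -natr1.
move: (pochhammer (a + 1) n) (pochhammer (b + 1) n) (pochhammer (c + 1) n)
  (pochhammer (d + 1) n) (pochhammer (e + 1) n) (n`!%:R : R[i]) (n%:R : R[i]).
move=> x1 x2 x3 x4 x5 x6 x7 y1 y2 y3 y4.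
by field; rewrite d0 e0 y1 y2 y3 y4.
Qed.

End Reduction.

(** * Recombination of the three Thomae transforms into the right-hand series *)

Theorem theorem4p1 (R : realType) (a b c d e f h s eta gamma1 gamma2 : R[i])
    (P2 : {poly R[i]})
    (s_def : s = d + e - a - b - c - 2)
    (eta_def : eta = - 2 * (h - c - 1) / (h - f - 1))
    (hf_neq0 : h - f - 1 != 0)
    (eta_neq : eta != 0 /\ eta != - 1)
    (ec_neq : e - c - 2 != 0 /\ e - c - 2 != - 1)
    (dc_neq : d - c - 2 != 0 /\ d - c - 2 != - 1)
    (P2_def : forall x : R[i], P2.[x] = P2_eval c d e h eta x)
    (P2_deg2 : size P2 = 3%N)
    (P2_roots : P2 = lead_coef P2 *: (('X - gamma1%:P) * ('X - gamma2%:P)))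
    (Re_s_gt0 : 0 < complex.Re s)
    (Re_c_gt0 : 0 < complex.Re c)
    (lower_left : no_nonpos_int [:: d; e; f; h])
    (lower_right : no_nonpos_int [:: s + a; s + b; - gamma1; - gamma2]) :
  [/\ hypergeometric_converges
        [:: a; b; c; f + 1; h + 1] [:: d; e; f; h] 1,
      hypergeometric_converges
        [:: s; e - c - 2; d - c - 2; 1 - gamma1; 1 - gamma2]
        [:: s + a; s + b; - gamma1; - gamma2] 1 &
      hypergeometric [:: a; b; c; f + 1; h + 1] [:: d; e; f; h] 1 =
        Gamma d * Gamma e * Gamma s
          / (f * h * Gamma c * Gamma (s + a) * Gamma (s + b))
        * hypergeometric
            [:: s; e - c - 2; d - c - 2; 1 - gamma1; 1 - gamma2]
            [:: s + a; s + b; - gamma1; - gamma2] 1].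
Proof.
have [eta0 eta1] := eta_neq; have [p0 p1] := ec_neq; have [q0 q1] := dc_neq.
have dN : forall n : nat, d != - n%:R by apply: lower_left; rewrite !inE eqxx.
have eN : forall n : nat, e != - n%:R by apply: lower_left; rewrite !inE eqxx orbT.
have fN : forall n : nat, f != - n%:R by apply: lower_left; rewrite !inE eqxx !orbT.
have hN : forall n : nat, h != - n%:R by apply: lower_left; rewrite !inE eqxx !orbT.
have uN : forall n : nat, s + a != - n%:R by apply: lower_right; rewrite !inE eqxx.
have vN : forall n : nat, s + b != - n%:R by apply: lower_right; rewrite !inE eqxx orbT.
have g1N : forall n : nat, - gamma1 != - n%:R by apply: lower_right; rewrite !inE eqxx !orbT.
have g2N : forall n : nat, - gamma2 != - n%:R by apply: lower_right; rewrite !inE eqxx !orbT.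
have cN := Re_gt0_neqN Re_c_gt0; have sN := Re_gt0_neqN Re_s_gt0.
have neq0 (x : R[i]) : (forall n : nat, x != - n%:R) -> x != 0.
  by move=> /(_ 0%N); rewrite oppr0.
have neq1 (x : R[i]) : (forall n : nat, x != - n%:R) -> x + 1 != 0.
  by move=> xN; exact: (neq0 _ (neqN_shift 1 xN)).
have Re_addn (x : R[i]) n : 0 < complex.Re x -> 0 < complex.Re (x + n%:R).
  by rewrite -natC; case: x => y z /= y0; rewrite ltr_wpDr.
have Gamma1 (x : R[i]) : (forall n : nat, x != - n%:R) -> Gamma (x + 1) = x * Gamma x.
  by move=> xN; rewrite (Gamma_pochhammer 1 xN) pochhammerSr pochhammer0 mul1r addr0.
have Gamma2 (x : R[i]) : (forall n : nat, x != - n%:R) ->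
    Gamma (x + 2) = x * (x + 1) * Gamma x.
  by move=> xN; rewrite (Gamma_pochhammer 2 xN) !pochhammerSr pochhammer0 mul1r addr0.
have s2E : s = d + e - a - b - (c + 2) by rewrite s_def; ring.
have s1E : s + 1 = d + e - a - b - (c + 1) by rewrite s_def; ring.
have s0E : s + 2 = d + e - a - b - c by rewrite s_def; ring.
have uN1 : forall n : nat, s + 1 + a != - n%:R.
  by rewrite addrAC; exact: (neqN_shift 1 uN).
have vN1 : forall n : nat, s + 1 + b != - n%:R.
  by rewrite addrAC; exact: (neqN_shift 1 vN).
have uN2 : forall n : nat, s + 2 + a != - n%:R.
  by rewrite addrAC; exact: (neqN_shift 2 uN).
have vN2 : forall n : nat, s + 2 + b != - n%:R.
  by rewrite addrAC; exact: (neqN_shift 2 vN).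
(* The smallest excess s goes with c + 2 and the smallest parameter c with s + 2, so Re s > 0 and Re
   c > 0 suffice for all three. *)
have [l2 F2 G2] := thomae s2E Re_s_gt0 (Re_addn _ 2 Re_c_gt0) dN eN uN vN.
have [l1 F1 G1] := thomae s1E (Re_addn _ 1 Re_s_gt0) (Re_addn _ 1 Re_c_gt0) dN eN uN1 vN1.
have [l0 F0 G0] := thomae s0E (Re_addn _ 2 Re_s_gt0) Re_c_gt0 dN eN uN2 vN2.
have SL := series_fxh dN eN fN hN F0 F1 F2.
have {}G2 : series (term3F2 s (e - c - 2) (d - c - 2) (s + a) (s + b)) @ \oo -->
    (Gamma (s + a) * Gamma (s + b) / Gamma s * l2 : (R[i] : numFieldType)).
  by move: G2; rewrite (_ : e - (c + 2) = e - c - 2) 1?(_ : d - (c + 2) = d - c - 2)//; ring.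
have {}G1 : series (term3F2 (s + 1) (e - c - 2 + 1) (d - c - 2 + 1) (s + a + 1) (s + b + 1)) @ \oo -->
    (Gamma (s + a + 1) * Gamma (s + b + 1) / Gamma (s + 1) * l1 : (R[i] : numFieldType)).
  move: G1; rewrite (addrAC s 1 a) (addrAC s 1 b).
  by rewrite (_ : e - (c + 1) = e - c - 2 + 1) 1?(_ : d - (c + 1) = d - c - 2 + 1)//; ring.
have {}G0 : series (term3F2 (s + 2) (e - c - 2 + 2) (d - c - 2 + 2) (s + a + 2) (s + b + 2)) @ \oo -->
    (Gamma (s + a + 2) * Gamma (s + b + 2) / Gamma (s + 2) * l0 : (R[i] : numFieldType)).
  move: G0; rewrite (addrAC s 2 a) (addrAC s 2 b).
  by rewrite !subrK.
have {}G1 := series_natmul_term3F2 uN vN G1.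
have {}G0 := series_natmul2_term3F2 uN vN G0.
have p2 : e - c - 1 != 0.
  by apply: contra_neq p1 => H; rewrite -[RHS]add0r -H; ring.
have q2 : d - c - 1 != 0.
  by apply: contra_neq q1 => H; rewrite -[RHS]add0r -H; ring.
have g10 : gamma1 != 0 by rewrite -oppr_eq0; exact: neq0.
have g20 : gamma2 != 0 by rewrite -oppr_eq0; exact: neq0.
pose alpha := (h + f - 2 * c - 1) / ((e - c - 2) * (d - c - 2)).
pose beta := (h - c) * (f - c) / (((e - c - 2) * (e - c - 1)) * ((d - c - 2) * (d - c - 1))).
have P2E x : P2.[x] = 1 + alpha * x + beta * (x * (x - 1)).
  by rewrite P2_def (P2_evalE _ hf_neq0 eta_def).
have P2F x : P2.[x] = lead_coef P2 * ((x - gamma1) * (x - gamma2)).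
  by rewrite {1}P2_roots hornerZ hornerM !hornerXsubC.
(* The 4F3 equals 1 at x = 0, which fixes the leading coefficient; the roots are nonzero because
   their negatives are lower parameters. *)
have lcP : lead_coef P2 = (gamma1 * gamma2)^-1.
  have := P2F 0; rewrite P2E !mulr0 mul0r mulr0 !addr0 !sub0r mulrNN => H.
  by rewrite -[RHS]mul1r [in RHS]H mulfK// mulf_neq0.
have SR := @cvgn_seriesD R[i] _ _ _ _ (@cvgn_seriesD R[i] _ _ _ _ G2
  (@cvgn_seriesZ R[i] alpha _ _ G1)) (@cvgn_seriesZ R[i] beta _ _ G0).
have tE : (fun n => term3F2 s (e - c - 2) (d - c - 2) (s + a) (s + b) n +
   alpha * (n%:R * term3F2 s (e - c - 2) (d - c - 2) (s + a) (s + b) n) +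
   beta * (n%:R * (n%:R - 1) * term3F2 s (e - c - 2) (d - c - 2) (s + a) (s + b) n)) =
  hypergeometric_term [:: s; e - c - 2; d - c - 2; 1 - gamma1; 1 - gamma2]
    [:: s + a; s + b; - gamma1; - gamma2] 1.
  apply/funext => n.
  transitivity (term3F2 s (e - c - 2) (d - c - 2) (s + a) (s + b) n * P2.[n%:R]).
    by rewrite P2E; ring.
  rewrite P2F lcP /hypergeometric_term !big_cons !big_nil !mulr1 expr1n mul1r.
  rewrite [1 - gamma1]addrC [1 - gamma2]addrC.
  rewrite [RHS](_ : _ = pochhammer s n * pochhammer (e - c - 2) n * pochhammer (d - c - 2) n /
    (pochhammer (s + a) n * pochhammer (s + b) n * n`!%:R) *
    (pochhammer (- gamma1 + 1) n / pochhammer (- gamma1) n) *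
    (pochhammer (- gamma2 + 1) n / pochhammer (- gamma2) n)); last first.
    by rewrite !invfM; ring.
  rewrite !pochhammer_succ_div// /term3F2 !invfM !invrN; ring.
rewrite tE in SR.
have L1 := @cvgn_lim R[i] _ _ SL; have L2 := @cvgn_lim R[i] _ _ SR.
split.
- exact: cvgP SL.
- exact: cvgP SR.
rewrite /hypergeometric L1 L2.
rewrite !Gamma1// !Gamma2// /alpha /beta.
have e1 : e - c - 2 + 1 = e - c - 1 by ring.
have d1 : d - c - 2 + 1 = d - c - 1 by ring.
rewrite e1 d1.
have := Gamma_neq0 cN; have := Gamma_neq0 sN; have := Gamma_neq0 uN; have := Gamma_neq0 vN.
have := neq0 _ fN; have := neq0 _ hN; have := neq0 _ cN; have := neq1 _ cN.
have := neq0 _ sN; have := neq1 _ sN; have := neq0 _ uN; have := neq1 _ uN.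
have := neq0 _ vN; have := neq1 _ vN; move: p0 p2 q0 q2.
clear.
(* What remains is a rational identity, linear in [l0], [l1], [l2], with the Gamma values as
   independent variables. *)
move: (Gamma d) (Gamma e) (Gamma c) (Gamma s) (Gamma (s + a)) (Gamma (s + b))
  (s + a) (s + b) (e - c - 2) (e - c - 1) (d - c - 2) (d - c - 1).
move=> Gd Ge Gc Gs Gu Gv u v p p' q q' h1 h2 h3 h4 h5 h6 h7 h8 h9 h10 h11 h12 h13 h14 h15 h16 h17 h18.
field; by rewrite h1 h2 h3 h4 h5 h6 h7 h8 h9 h10 h11 h12 h13 h14 h15 h16 h17 h18.
Qed.
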